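(* A Banach algebra $A$ is boundedly approximately semi-contractible if and only if there are a constant $K>0$ and nets $(\xi_i)$, $(\eta_i)$ (over the same directed set) in $A^{\#}\widehat{\otimes}A^{\#}$ such that: (1) $a\cdot\xi_i-\eta_i\cdot a\to 0$ for every $a\in A$; (2) for all $i$, $\|\mathrm{ad}_{\xi_i,\eta_i}\|\le K$; (3) for all $i$, $\pi(\xi_i)=e$ and $\pi(\eta_i)=e$.
   Context: $A^{\#}$ is the unitization of $A$ with adjoined identity $e$; $A^{\#}\widehat{\otimes}A^{\#}$ is the projective tensor product, a Banach $A$-bimodule via $a\cdot(b\otimes c)=ab\otimes c$, $(b\otimes c)\cdot a=b\otimes ca$; $\pi:A^{\#}\widehat{\otimes}A^{\#}\to A^{\#}$ is the product map $\pi(b\otimes c)=bc$. For elements $\xi,\eta$ of a Banach $A$-bimodule $Y$, $\mathrm{ad}_{\xi,\eta}:A\to Y$ is $a\mapsto a\cdot\xi-\eta\cdot a$, and $\|\mathrm{ad}_{\xi,\eta}\|$ its operator norm. A derivation is a linear $D:A\to Y$ with $D(ab)=a\cdot D(b)+D(a)\cdot b$. A continuous derivation $D:A\to Y$ is boundedly approximately semi-inner if there are $K>0$ and nets $(\xi_i),(\eta_i)$ in $Y$ with $D(a)=\lim_i(a\cdot\xi_i-\eta_i\cdot a)$ in norm for all $a\in A$ and $\|\mathrm{ad}_{\xi_i,\eta_i}\|\le K$ for all $i$. $A$ is boundedly approximately semi-contractible if for every Banach $A$-bimodule $Y$ every continuous derivation $A\to Y$ is boundedly approximately semi-inner. *)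

(* Defs.v *)
From mathcomp Require Import all_boot all_order all_algebra.
From mathcomp Require Import all_classical all_reals all_analysis.
From mathcomp Require Import complex.
Import Order.TTheory GRing.Theory Num.Theory numFieldNormedType.Exports.

Set Implicit Arguments.
Unset Strict Implicit.
Unset Printing Implicit Defensive.

Local Open Scope classical_set_scope.
Local Open Scope ring_scope.

(* The complex field, seen as a numFieldType (so that it carries its
   canonical normed/topological structure). *)
Definition Cplx (R : realType) : numFieldType := R[i].

Definition directed (I : Type) (le : I -> I -> Prop) : Prop :=
  [/\ inhabited I,
      (forall i, le i i),
      (forall i j k, le i j -> le j k -> le i k) &
      (forall i j, exists k, le i k /\ le j k)].

Section Defs.
Variable K : numFieldType.

Definition net_cvg (V : normedModType K) (I : Type) (le : I -> I -> Prop)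
    (f : I -> V) (l : V) : Prop :=
  forall e : K, 0 < e -> exists i0, forall i, le i0 i -> `|f i - l| < e.

Variable A : completeNormedModType K.

Definition is_banach_algebra (mul : A -> A -> A) : Prop :=
  [/\ (forall a b c, mul a (mul b c) = mul (mul a b) c),
      (forall (k : K) a b c, mul (k *: a + b) c = k *: mul a c + mul b c),
      (forall (k : K) a b c, mul a (k *: b + c) = k *: mul a b + mul a c) &
      (forall a b, `|mul a b| <= `|a| * `|b|)].

Variable mul : A -> A -> A.

Definition is_banach_bimodule (Y : completeNormedModType K)
    (lact : A -> Y -> Y) (ract : Y -> A -> Y) : Prop :=
  (forall (k : K) a b y, lact (k *: a + b) y = k *: lact a y + lact b y)
  /\ (forall (k : K) a y z, lact a (k *: y + z) = k *: lact a y + lact a z)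
  /\ (forall (k : K) y z a, ract (k *: y + z) a = k *: ract y a + ract z a)
  /\ (forall (k : K) y a b, ract y (k *: a + b) = k *: ract y a + ract y b)
  /\ (forall a b y, lact (mul a b) y = lact a (lact b y))
  /\ (forall y a b, ract y (mul a b) = ract (ract y a) b)
  /\ (forall a y b, ract (lact a y) b = lact a (ract y b))
  /\ (exists C : K, 0 < C /\ forall a y,
          `|lact a y| <= C * `|a| * `|y| /\ `|ract y a| <= C * `|a| * `|y|).

Definition is_derivation (Y : completeNormedModType K)
    (lact : A -> Y -> Y) (ract : Y -> A -> Y) (D : A -> Y) : Prop :=
  (forall (k : K) a b, D (k *: a + b) = k *: D a + D b) /\
  (forall a b, D (mul a b) = lact a (D b) + ract (D a) b).

Definition bdd_approx_semi_inner (Y : completeNormedModType K)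
    (lact : A -> Y -> Y) (ract : Y -> A -> Y) (D : A -> Y) : Prop :=
  exists (Kc : K), 0 < Kc /\
  exists (I : Type) (le : I -> I -> Prop) (xi eta : I -> Y),
    [/\ directed le,
        (forall a, net_cvg le (fun i => lact a (xi i) - ract (eta i) a) (D a)) &
        (forall i a, `|lact a (xi i) - ract (eta i) a| <= Kc * `|a|)].

Definition bdd_approx_semi_contractible : Prop :=
  forall (Y : completeNormedModType K) (lact : A -> Y -> Y) (ract : Y -> A -> Y),
    is_banach_bimodule lact ract ->
    forall D : A -> Y, is_derivation lact ract D -> continuous D ->
      bdd_approx_semi_inner lact ract D.

(* The unitization A# = A (+) K, elements (a, l) = a + l e,            *)
(* with norm ||(a,l)|| = ||a|| + |l| and product                       *)
(* (a,l)(b,m) = (ab + m a + l b, l m).                                 *)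
Definition unorm (x : A * K) : K := `|x.1| + `|x.2|.

Definition umul (x y : A * K) : A * K :=
  (mul x.1 y.1 + y.2 *: x.1 + x.2 *: y.1, x.2 * y.2).

Definition uunit : A * K := (0, 1).

Definition uemb (a : A) : A * K := (a, 0).

(* The projective tensor product A# (^) A#.                            *)
(* Every element of X (^) Y is a sum  sum_n x_n (x) y_n  with          *)
(* sum_n ||x_n|| ||y_n|| < oo; we represent elements by such           *)
(* absolutely summable representations.                                *)
Record trep := TRep { tl : nat -> A * K ; tr : nat -> A * K }.

Definition rep_mass (u : trep) : nat -> K :=
  fun N => \sum_(0 <= n < N) unorm (tl u n) * unorm (tr u n).

Definition summable_rep (u : trep) : Prop :=
  exists l : K, rep_mass u @ \oo --> l.

(* bounded bilinear forms on A# x A#; the dual of A# (^) A# *)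
Definition bdd_bilinear (B : A * K -> A * K -> K) : Prop :=
  [/\ (forall (k : K) x y z, B (k *: x + y) z = k * B x z + B y z),
      (forall (k : K) x y z, B x (k *: y + z) = k * B x y + B x z) &
      (exists C : K, forall x y, `|B x y| <= C * unorm x * unorm y)].

Definition rep_eval (B : A * K -> A * K -> K) (u : trep) : nat -> K :=
  fun N => \sum_(0 <= n < N) B (tl u n) (tr u n).

(* two representations define the same element of A# (^) A#:
   they agree under every bounded bilinear form *)
Definition trep_eq (u v : trep) : Prop :=
  forall B, bdd_bilinear B -> limn (rep_eval B u) = limn (rep_eval B v).

(* ||u||_proj <= c  (the projective norm is the infimum of
   sum_n ||x_n|| ||y_n|| over all representations of the element) *)
Definition tnorm_le (u : trep) (c : K) : Prop :=
  forall e : K, 0 < e -> exists v : trep,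
    [/\ summable_rep v, trep_eq u v & limn (rep_mass v) <= c + e].

Definition tlact (a : A) (u : trep) : trep :=
  TRep (fun n => umul (uemb a) (tl u n)) (tr u).

Definition tract (u : trep) (a : A) : trep :=
  TRep (tl u) (fun n => umul (tr u n) (uemb a)).

(* difference u - v, by interleaving the two representations *)
Definition tsub (u v : trep) : trep :=
  TRep (fun n => if odd n then - tl v n./2 else tl u n./2)
       (fun n => if odd n then tr v n./2 else tr u n./2).

Definition tpi_is (u : trep) (x : A * K) : Prop :=
  (fun N => \sum_(0 <= n < N) umul (tl u n) (tr u n)) @ \oo --> x.

End Defs.

(* Main.v *)
From HB Require Import structures.
Require Import Defs.
From mathcomp Require Import all_boot all_order all_algebra.
From mathcomp Require Import all_classical all_reals all_analysis.
From mathcomp Require Import complex ring lra zify.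
Import Order.TTheory GRing.Theory Num.Theory numFieldNormedType.Exports.

(* If [pi eta_i = e], the module map [Psi (b (x) c) = b . D c] satisfies
   [Psi (a xi_i - eta_i a) = a . Psi xi_i - Psi eta_i . a - D a], so [D] is the
   limit of the maps [ad_{Psi xi_i, Psi eta_i}]. As equality in the tensor product
   is tested by scalar bilinear forms only, Hahn-Banach is what makes [Psi]
   well defined.

   Conversely, [a |-> a (x) e - e (x) a] is a derivation into the Banach bimodule
   [ker pi]. If it is approximated by [ad_{x_i, y_i}], then [xi_i = e (x) e - x_i]
   and [eta_i = e (x) e - y_i] are the required nets. The kernel is realised as a
   space of functionals on the bounded bilinear forms, normed by the infimum of
   the masses of the representations [u] with [pi u = 0]. *)

Set Implicit Arguments.
Unset Strict Implicit.
Unset Printing Implicit Defensive.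

Local Open Scope classical_set_scope.
Local Open Scope ring_scope.

(** * Hahn-Banach *)

(** The choice of [ker pi] as target is what produces condition (3): each [x_i] in it has product
    [0], so [e (x) e - x_i] has product exactly [e] at every index, not only in the limit. In the
    full tensor product the same derivation is inner, implemented by [e (x) e], and approximating it
    would give no information. Tensors exist only as absolutely summable representations. Estimates
    are therefore bounds on all partial masses ([mass_le]), and sums, differences and countable sums
    of tensors are rearrangements of representations; completeness of the kernel rests on such a
    rearrangement. The scalars are complex, hence only partially ordered: suprema, infima and
    monotone convergence are taken over the reals and transported by [toC] and [fromC]. *)

Section HahnBanach.
Variables (R : realType) (V : lmodType R) (p : V -> R).
Hypothesis p_subadditive : forall x y, p (x + y) <= p x + p y.
Hypothesis p_homogeneous : forall r x, 0 <= r -> p (r *: x) = r * p x.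
Variable y : V.

Definition linear_graph (G : set (V * R)) :=
  forall r u v, G u -> G v -> G (r *: u.1 + v.1, r * u.2 + v.2).

Definition dominated_graph (G : set (V * R)) :=
  forall u, G u -> u.2 <= p u.1.

(* The last clause tolerates the empty graph, the union of the empty chain. *)
Definition partial_functional (G : set (V * R)) :=
  [/\ linear_graph G, dominated_graph G & G !=set0 -> G (y, p y)].

Lemma sublinear0 : p 0 = 0.
Proof. by rewrite -(scale0r (0 : V)) p_homogeneous ?mul0r. Qed.

Lemma partial_functional_line :
  partial_functional [set u | exists t, u = (t *: y, t * p y)].
Proof.
split.
- move=> r _ _ [s ->] [t ->] /=; exists (r * s + t).
  by rewrite scalerDl scalerA mulrDl mulrA.
- move=> _ [t ->] /=; have [t0|t0] := leP 0 t; first by rewrite p_homogeneous.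
  (* For [t < 0], [0 = p 0 <= p (t y) + p (- t y)] and [p (- t y) = - t p y]. *)
  have := p_subadditive (t *: y) (- t *: y).
  rewrite -scalerDl subrr scale0r sublinear0 (@p_homogeneous (- t)).
    by lra.
  by rewrite oppr_ge0 ltW.
- by move=> _; exists 1; rewrite scale1r mul1r.
Qed.

Lemma partial_functional_bigcup (F : set (set (V * R))) :
  F `<=` partial_functional -> total_on F subset ->
  partial_functional (\bigcup_(G in F) G).
Proof.
move=> FP Ftot; split.
- move=> r u v [G FG Gu] [H FH Hv].
  have [GH|HG] := Ftot _ _ FG FH.
  + by exists H => //; have [+ _ _] := FP _ FH; apply=> //; exact: GH.
  + by exists G => //; have [+ _ _] := FP _ FG; apply=> //; exact: HG.
- by move=> u [G FG Gu]; have [_ + _] := FP _ FG; apply.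
- move=> [u [G FG Gu]]; exists G => //; have [_ _ +] := FP _ FG.
  by apply; exists u.
Qed.

Lemma graph0 G : partial_functional G -> G !=set0 -> G (0, 0).
Proof.
move=> [Glin _ _] [u Gu]; have := Glin (-1) _ _ Gu Gu.
by rewrite scaleN1r mulN1r !addNr.
Qed.

Lemma graphZ G r u : partial_functional G -> G u -> G (r *: u.1, r * u.2).
Proof.
move=> PG Gu; have G0 : G (0, 0) by apply: graph0 => //; exists u.
by have [+ _ _] := PG => /(_ r _ _ Gu G0); rewrite !addr0.
Qed.

Definition one_dim_extension (G : set (V * R)) z c : set (V * R) :=
  [set u | exists v t, G v /\ u = (v.1 + t *: z, v.2 + t * c)].

(** By positive homogeneity, domination at [v + t z] only has to be tested at [t = 1] and [t = -1],
    and these two cases are the bounds assumed on [c]. *)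
Lemma partial_functional_extension G z c :
  partial_functional G -> G !=set0 ->
  (forall u, G u -> u.2 - p (u.1 - z) <= c) ->
  (forall u, G u -> c <= p (u.1 + z) - u.2) ->
  partial_functional (one_dim_extension G z c).
Proof.
move=> PG G0 lec gec; split.
- move=> r _ _ [u [s [Gu ->]]] [v [t [Gv ->]]] /=.
  exists (r *: u.1 + v.1, r * u.2 + v.2), (r * s + t); split.
    by have [+ _ _] := PG; apply.
  congr pair; last by rewrite /=; ring.
  by rewrite /= scalerDr scalerA scalerDl addrACA.
- move=> _ [v [t [Gv ->]]] /=; have [t0|t0|<-] := ltgtP 0 t.
  + have := gec _ (graphZ t^-1 PG Gv); rewrite /= -(ler_pM2l t0) mulrBr.
    rewrite -p_homogeneous; last exact: ltW.
    rewrite scalerDr scalerA mulrA mulfV ?gt_eqF//.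
    by rewrite scale1r mul1r; lra.
  + have s0 : 0 < - t by rewrite oppr_gt0.
    have := lec _ (graphZ (- t)^-1 PG Gv); rewrite /= -(ler_pM2l s0) mulrBr.
    rewrite -p_homogeneous; last exact: ltW.
    rewrite scalerBr scalerA mulrA mulfV ?gt_eqF//.
    by rewrite scale1r mul1r scaleNr opprK; lra.
  + by rewrite scale0r mul0r !addr0; have [_ + _] := PG; apply.
- move=> _; exists (y, p y), 0; rewrite scale0r mul0r !addr0; split => //.
  by have [_ _] := PG; apply.
Qed.

(** Domination and subadditivity give [u.2 + v.2 <= p (u.1 + v.1) <= p (u.1 - z) + p (v.1 + z)], so
    every lower bound for the new value lies below every upper bound, and the supremum of the lower
    bounds fits. *)
Lemma extension_value G z : partial_functional G -> G !=set0 ->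
  exists c, (forall u, G u -> u.2 - p (u.1 - z) <= c) /\
            (forall u, G u -> c <= p (u.1 + z) - u.2).
Proof.
move=> PG [w Gw]; pose S := [set u.2 - p (u.1 - z) | u in G].
have cross u v : G u -> G v -> u.2 - p (u.1 - z) <= p (v.1 + z) - v.2.
  move=> Gu Gv; have [Glin Gdom _] := PG.
  have := Gdom _ (Glin 1 _ _ Gu Gv); rewrite /= scale1r mul1r => uv.
  have := p_subadditive (u.1 - z) (v.1 + z).
  by rewrite addrACA addNr addr0; lra.
have S0 : S !=set0 by exists (w.2 - p (w.1 - z)), w.
exists (sup S); split=> u Gu.
- apply: ub_le_sup; last by exists u.
  by exists (p (w.1 + z) - w.2) => _ [v Gv <-]; exact: cross.
- by apply: ge_sup => // _ [v Gv <-]; exact: cross.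
Qed.

Theorem hahn_banach : exists f : V -> R,
  [/\ forall r x z, f (r *: x + z) = r * f x + f z,
      forall x, f x <= p x & f y = p y].
Proof.
have [G [PG Gmax]] := Zorn_bigcup partial_functional_bigcup.
(* A maximal graph could a priori be empty; the line through [y] would then be strictly larger. *)
have G0 : G !=set0.
  apply/set0P/eqP => GE; apply: (Gmax _ _ partial_functional_line).
  rewrite GE; split=> // /(_ (y, p y)); apply.
  by exists 1; rewrite scale1r mul1r.
have total x : exists r, G (x, r).
  apply/not_existsP => Gx.
  have [c [lec gec]] := extension_value x PG G0.
  apply: (Gmax (one_dim_extension G x c)).
    split=> [u Gu|/(_ (x, c)) Gext].
      exists u, 0; split=> //.
      by rewrite scale0r mul0r !addr0; case: u {Gu}.
    apply: (Gx c); apply: Gext; exists (0, 0), 1; split; first exact: graph0.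
    by rewrite scale1r mul1r !add0r.
  exact: partial_functional_extension.
have [f Gf] := choice total; have [Glin Gdom Gy] := PG.
(* The difference of two values at [x] is a value at [0], hence at most [p 0 = 0]; by symmetry the
   values agree. *)
have uniq x r s : G (x, r) -> G (x, s) -> r = s.
  suff le r' s' : G (x, r') -> G (x, s') -> r' <= s'.
    by move=> Gr Gs; apply/eqP; rewrite eq_le !le.
  move=> Gr Gs; have := Gdom _ (Glin (-1) _ _ Gs Gr).
  by rewrite /= scaleN1r addNr sublinear0; lra.
exists f; split=> [r x z|x|].
- exact: (uniq _ _ _ (Gf _) (Glin r _ _ (Gf x) (Gf z))).
- exact: Gdom (Gf x).
- exact: uniq (Gf y) (Gy G0).
Qed.

End HahnBanach.

(** * Real and complex scalars, and separation by complex functionals *)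

Definition toC (R : realType) (r : R) : Cplx R := (r%:C)%C.
Definition fromC (R : realType) (z : Cplx R) : R := complex.Re z.

Section ComplexNorm.
Variable R : realType.
Implicit Types (r s : R) (z w : Cplx R).

Lemma toCD r s : toC (r + s) = toC r + toC s.
Proof. exact: (rmorphD (real_complex R)). Qed.
Lemma toCM r s : toC (r * s) = toC r * toC s.
Proof. exact: (rmorphM (real_complex R)). Qed.
Lemma toC0 : toC (0 : R) = 0. Proof. by []. Qed.
Lemma ler_toC r s : (toC r <= toC s) = (r <= s).
Proof. exact: lecR. Qed.
Lemma ltr_toC r s : (toC r < toC s) = (r < s).
Proof. exact: ltcR. Qed.
Lemma fromCD z w : fromC (z + w) = fromC z + fromC w.
Proof. by case: z w => [a b] [c d]. Qed.
Lemma fromCK z : 0 <= z -> toC (fromC z) = z.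
Proof. by move=> /ger0_real/RRe_real. Qed.
Lemma norm_toC r : `|toC r| = toC `|r|.
Proof. by rewrite normc_def /= expr0n/= addr0 sqrtr_sqr. Qed.

Lemma Re_sum (I : Type) (s : seq I) (f : I -> Cplx R) :
  fromC (\sum_(i <- s) f i) = \sum_(i <- s) fromC (f i).
Proof. exact: (big_morph _ fromCD). Qed.

End ComplexNorm.

(** An alias, so that the real action obtained by restriction of scalars does not clash with the
    complex structure of [V]. *)
Definition realified (R : realType) (V : lmodType (Cplx R)) : Type := V.
HB.instance Definition _ (R : realType) (V : lmodType (Cplx R)) :=
  GRing.Zmodule.on (realified V).

Section Realified.
Variables (R : realType) (V : lmodType (Cplx R)).

Definition rscale (r : R) (x : realified V) : realified V := toC r *: (x : V).
Lemma rscaleA a b v : rscale a (rscale b v) = rscale (a * b) v.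
Proof. by rewrite /rscale scalerA toCM. Qed.
Lemma rscale1 : left_id 1 rscale.
Proof. exact: scale1r. Qed.
Lemma rscaleDr : right_distributive rscale +%R.
Proof. by move=> a u v; exact: scalerDr. Qed.
Lemma rscaleDl v : {morph rscale^~ v : a b / a + b}.
Proof. by move=> a b; rewrite /rscale toCD scalerDl. Qed.
HB.instance Definition _ := GRing.Zmodule_isLmodule.Build R (realified V)
  rscaleA rscale1 rscaleDr rscaleDl.
End Realified.

(* The complex functional is recovered from its real part [g] as
   [g x - i g (i x)]; the crude bound 2 avoids the usual rotation argument. *)
Lemma normed_separation (R : realType) (V : normedModType (Cplx R)) (y : V) :
  y <> 0 -> exists f : V -> Cplx R,
  [/\ forall k x z, f (k *: x + z) = k * f x + f z,
      forall x, `|f x| <= 2 * `|x| & f y <> 0].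
Proof.
move=> y0; pose p (x : realified V) : R := fromC `|(x : V)|.
have pE x : toC (p x) = `|(x : V)| by rewrite fromCK.
have pD x z : p (x + z) <= p x + p z.
  by rewrite -ler_toC toCD !pE; exact: ler_normD.
have pZ r x : 0 <= r -> p (r *: x) = r * p x.
  move=> r0; apply: (@complexI R); rewrite -/(toC _) -/(toC (r * _)) toCM !pE.
  by rewrite normrZ norm_toC ger0_norm.
have [g [glin gp gy]] := hahn_banach pD pZ (y : realified V).
pose ii : Cplx R := ('i)%C.
pose f (x : V) : Cplx R := toC (g x) - ii * toC (g (ii *: x)).
have gD x z : g (x + z) = g x + g z by rewrite -[x]scale1r glin mul1r scale1r.
have g0 : g 0 = 0.
  by apply: (@addrI _ (g 0)); rewrite -gD !addr0.
have gZ (r : R) (x : V) : g (toC r *: x) = r * g x.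
  by have := glin r x 0; rewrite g0 !addr0.
have gZi (a b : R) (x : V) :
    g (((a +i* b)%C : Cplx R) *: x) = a * g x + b * g (ii *: x).
  have -> : ((a +i* b)%C : Cplx R) = toC a + toC b * ii.
    by rewrite /toC /ii; simpc.
  by rewrite scalerDl gD -scalerA !gZ.
exists f; split.
- move=> [a b] x z; rewrite /f.
  rewrite scalerDr !gD (gZi a b) scalerA.
  have -> : ii * ((a +i* b)%C : Cplx R) = ((- b) +i* a)%C.
    by rewrite /ii; simpc.
  rewrite (gZi (- b) a) /ii /toC; apply/eqP; rewrite eq_complex /=.
  by apply/andP; split; apply/eqP; ring.
(* Since [p] is even, the one-sided bound [g <= p] also bounds [- g]. *)
- have gabs x : `|g x| <= p x.
    rewrite ler_norml gp andbT lerNl.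
    have -> : - g x = g (- x).
      by apply/eqP; rewrite eq_sym -subr_eq0 opprK -gD addNr g0.
    by apply: (le_trans (gp _)); rewrite /p normrN.
  move=> x; apply: (le_trans (ler_normB _ _)).
  rewrite normrM !norm_toC.
  have -> : `|ii| = 1 by rewrite /ii normc_def /= expr0n expr1n add0r sqrtr1.
  rewrite mul1r mulr_natl mulr2n lerD// -?pE ?ler_toC//.
  apply: (le_trans (gabs _)); rewrite /p normrZ.
  have -> : `|ii| = 1 by rewrite /ii normc_def /= expr0n expr1n add0r sqrtr1.
  by rewrite mul1r.
(* The real part of [f y] is [g y = p y], the norm of [y]. *)
- move=> fy0; apply: y0; apply/normr0_eq0; rewrite -pE -gy.
  suff -> : g y = fromC (f y) by rewrite fy0.
  by rewrite /f /fromC /ii /toC /=; ring.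
Qed.

(** * Absolutely convergent series *)

Section ComplexSeries.
Variable R : realType.
Local Notation K := (Cplx R).

Lemma cvg_toC (u : nat -> R) (l : R) : u @ \oo --> l -> toC (u n) @[n --> \oo] --> toC l.
Proof.
move=> ul; apply/cvgrPdist_lt => e e0.
have e0' : 0 < fromC e by rewrite -ltr_toC fromCK ?ltW.
have /cvgrPdist_lt /(_ _ e0') := ul; apply: filterS => n.
rewrite -ltr_toC (fromCK (ltW e0)) -norm_toC.
by congr (`|_| < _); rewrite /toC rmorphB.
Qed.

(** Nonnegative complex numbers are real, so monotone convergence applies to the real parts. *)
Lemma bounded_nonneg_series_cvg (f : nat -> K) (c : K) :
  (forall n, 0 <= f n) -> (forall N, \sum_(0 <= n < N) f n <= c) ->
  exists l : K, [/\ (fun N => \sum_(0 <= n < N) f n) @ \oo --> l, l <= c &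
                  forall N, \sum_(0 <= n < N) f n <= l].
Proof.
move=> f0 fc; pose g n := fromC (f n).
have sE N : \sum_(0 <= n < N) f n = toC (series g N).
  by rewrite /series /= -Re_sum fromCK// sumr_ge0.
have c0 : 0 <= c by have := fc 0%N; rewrite big_geq.
have gc N : series g N <= fromC c by rewrite -ler_toC -sE fromCK.
have ndg : nondecreasing_seq (series g).
  by apply: nondecreasing_series => n _ _; rewrite -ler_toC fromCK.
have cg : cvgn (series g).
  by apply: nondecreasing_is_cvgn => //; exists (fromC c) => _ [N _ <-].
exists (toC (limn (series g))); split.
- under eq_fun do rewrite sE; exact: cvg_toC.
- rewrite -(fromCK c0) ler_toC; apply: limr_le => //; exact: nearW.
- by move=> N; rewrite sE ler_toC; exact: nondecreasing_cvgn_le.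
Qed.

Lemma abs_bounded_series_cauchy (V : normedModType K) (f : nat -> V) (c : K) :
  (forall N, \sum_(0 <= n < N) `|f n| <= c) -> cauchy (series f @ \oo).
Proof.
move=> fc.
have [l [fl _ _]] := bounded_nonneg_series_cvg (fun n => normr_ge0 (f n)) fc.
have cl : cvgn (series (fun n => `|f n|)) by apply/cvg_ex; exists l.
have /cvg_cauchy/cauchy_seriesP su := cl.
apply/cauchy_seriesP => e /su; apply: filterS => n /=.
rewrite ger0_norm ?sumr_ge0//.
by apply: le_lt_trans; apply: ler_norm_sum.
Qed.

(** The form of completeness in which sums over representations are formed. It passes to products
    coordinatewise, which is how [A * K], the target of the product map, obtains it. *)
Definition series_complete (V : normedModType K) := forall (f : nat -> V) (c : K),
  (forall N, \sum_(0 <= n < N) `|f n| <= c) ->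
  exists l : V, (fun N => \sum_(0 <= n < N) f n) @ \oo --> l.

Lemma series_complete_complete (V : completeNormedModType K) : series_complete V.
Proof. by move=> f c /abs_bounded_series_cauchy/cauchy_cvg/cvg_ex. Qed.

Lemma normC_ge_Im (z : K) : toC `|complex.Im z| <= `|z|.
Proof.
have := normc_ge_Re ('i%C * z : K); rewrite normrM.
have -> : `|'i%C : K| = 1 by rewrite normc_def /= expr0n expr1n add0r sqrtr1.
by case: z => a b /=; rewrite mul1r mul0r mul1r sub0r normrN.
Qed.

Lemma series_complete_Cplx : series_complete K.
Proof.
move=> f c fc.
have part (h : K -> R) : (forall z, toC `|h z| <= `|z|) ->
    cvgn (series (fun n => h (f n))).
  move=> hz; apply: normed_cvg.
  apply: (@nondecreasing_is_cvgn _ (series (fun n => `|h (f n)|))).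
    by apply: nondecreasing_series => n _ _; exact: normr_ge0.
  exists (fromC c) => _ [N _ <-]; rewrite -ler_toC fromCK; last first.
    by have := fc 0%N; rewrite big_geq.
  apply: le_trans (fc N); rewrite /series /= (big_morph (@toC R) (@toCD R) (toC0 R)).
  by apply: ler_sum => n _; exact: hz.
have /cvg_ex[a fa] := part (@fromC R) (@normc_ge_Re R).
have /cvg_ex[b fb] := part (@complex.Im R) normC_ge_Im.
exists (toC a + 'i%C * toC b).
have -> : (fun N => \sum_(0 <= n < N) f n) =
  (fun N => toC (series (fun n => fromC (f n)) N) +
            'i%C * toC (series (fun n => complex.Im (f n)) N)).
  apply/funext => N; rewrite /series /=.
  rewrite !(big_morph (@toC R) (@toCD R) (toC0 R)) mulr_sumr -big_split/=.
  by apply: eq_bigr => n _; exact: complexE.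
apply: cvgD; first exact: cvg_toC.
by apply: cvgMl_tmp; exact: cvg_toC.
Qed.

Lemma series_complete_prod (U V : normedModType K) :
  series_complete U -> series_complete V -> series_complete (U * V)%type.
Proof.
move=> cU cV f c fc.
have nfst (x : U * V) : `|x.1| <= `|x|.
  by rewrite prod_normE comparable_le_max ?lexx// real_comparable.
have nsnd (x : U * V) : `|x.2| <= `|x|.
  by rewrite prod_normE comparable_le_max ?lexx ?orbT// real_comparable.
have [a fa] : exists a : U, (fun N => \sum_(0 <= n < N) (f n).1) @ \oo --> a.
  apply: (cU _ c) => N; apply: le_trans (fc N).
  by apply: ler_sum => n _; exact: nfst.
have [b fb] : exists b : V, (fun N => \sum_(0 <= n < N) (f n).2) @ \oo --> b.
  apply: (cV _ c) => N; apply: le_trans (fc N).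
  by apply: ler_sum => n _; exact: nsnd.
exists (a, b).
have -> : (fun N => \sum_(0 <= n < N) f n) =
   (fun N => (\sum_(0 <= n < N) (f n).1, \sum_(0 <= n < N) (f n).2)).
  apply/funext => N; elim: N => [|N IH]; first by rewrite !big_geq.
  by rewrite !big_nat_recr//= IH.
exact: cvg_pair.
Qed.

Lemma bounded_additive_continuous (V W : normedModType K) (g : V -> W) (C : K) :
  0 <= C -> (forall x y, g (x - y) = g x - g y) ->
  (forall x, `|g x| <= C * `|x|) -> continuous g.
Proof.
move=> C0 gB gC l; apply/cvgrPdist_lt => e e0.
(* Dividing by [C + 1] instead of [C] covers [C = 0]; the same device recurs in later estimates. *)
have C1 : 0 < C + 1 by rewrite ltr_wpDl.
have /cvgrPdist_lt /(_ _ (divr_gt0 e0 C1)) := @cvg_id _ (nbhs l).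
apply: filterS => x lx; rewrite -gB; apply: le_lt_trans (gC _) _.
apply: (@le_lt_trans _ _ ((C + 1) * `|l - x|)).
  by rewrite ler_wpM2r// lerDl.
by rewrite mulrC -ltr_pdivlMr.
Qed.

Lemma cvg_bounded_additive (V W : normedModType K) (g : V -> W) (C : K)
    (u : nat -> V) (l : V) :
  0 <= C -> (forall x y, g (x - y) = g x - g y) ->
  (forall x, `|g x| <= C * `|x|) ->
  u @ \oo --> l -> g (u n) @[n --> \oo] --> g l.
Proof.
move=> C0 gB gC; apply: continuous_cvg.
exact: (bounded_additive_continuous C0 gB gC).
Qed.

Lemma cvg_norm_le (V : normedModType K) (u : nat -> V) (l : V) (c : K) :
  u @ \oo --> l -> (forall n, `|u n| <= c) -> `|l| <= c.
Proof.
move=> ul uc; have c0 : 0 <= c := le_trans (normr_ge0 _) (uc 0%N).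
rewrite real_leNgt ?ger0_real//; apply/negP => cl.
have /cvgrPdist_lt /(_ (`|l| - c)) := ul; rewrite subr_gt0 => /(_ cl).
move=> [N _ /(_ N (leqnn N))] /=; rewrite ltrBrDr => lN.
suff : `|l| < `|l| by rewrite ltxx.
rewrite -{1}(subrK (u N) l); apply: le_lt_trans (ler_normD _ _) _.
by apply: le_lt_trans lN; rewrite lerD2l.
Qed.

End ComplexSeries.

(** * Merging sequences of terms into one series *)

Definition interleave (T : Type) (f g : nat -> T) : nat -> T :=
  fun n => if odd n then g n./2 else f n./2.

(* Sequence [j] is placed at the indices [n] with [n.+1 = 2 ^ j * (2 * m + 1)]. *)
Definition spread (T : Type) (w : nat -> nat -> T) : nat -> T :=
  fun n => w (logn 2 n.+1) (n.+1 %/ 2 ^ (logn 2 n.+1).+1)%N.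

(** At even [n] the number [n.+1] is odd, so the term belongs to row [0]; at odd [n] one has
    [n.+1 = 2 * n./2.+1], and removing the factor 2 lowers the row by one. This recursion is what
    the later inductions use. *)
Lemma spreadE (T : Type) (w : nat -> nat -> T) :
  spread w = interleave (w 0%N) (spread (fun j => w j.+1)).
Proof.
apply/funext => n; rewrite /spread /interleave; case: ifPn => on.
  have n2 : n.+1 = (2 * n./2.+1)%N by lia.
  have -> : logn 2 n.+1 = (logn 2 n./2.+1).+1 by rewrite n2 lognM.
  by rewrite [in X in (X %/ _)%N]n2 [in X in (_ %/ X)%N]expnS divnMl.
have -> : logn 2 n.+1 = 0%N.
  by apply/eqP; rewrite -leqn0 leqNgt logn_gt0 mem_primes /= dvdn2 /= negbK.
by congr (w _ _); rewrite expn1; lia.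
Qed.

Lemma sum_interleave (V : zmodType) (f g : nat -> V) N :
  \sum_(0 <= n < N) interleave f g n =
  \sum_(0 <= n < uphalf N) f n + \sum_(0 <= n < N./2) g n.
Proof.
elim: N => [|N IH]; first by rewrite !big_geq// addr0.
rewrite big_nat_recr//= IH /interleave; case: ifPn => oN.
  have -> : uphalf N = N./2.+1 by lia.
  by rewrite [in RHS]big_nat_recr//= !big_nat_recr//= addrA.
have -> : uphalf N = N./2 by lia.
by rewrite big_nat_recr//= addrAC.
Qed.

Section SpreadSeries.
Variable R : realType.
Local Notation K := (Cplx R).

Lemma cvg_interleave (V : normedModType K) (f g : nat -> V) (a b : V) :
  (fun N => \sum_(0 <= n < N) f n) @ \oo --> a ->
  (fun N => \sum_(0 <= n < N) g n) @ \oo --> b ->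
  (fun N => \sum_(0 <= n < N) interleave f g n) @ \oo --> a + b.
Proof.
move=> fa gb; under eq_fun do rewrite sum_interleave.
apply: cvgD.
- apply: (cvg_comp uphalf _ _ fa) => S [N _ NS].
  by exists N.*2 => // n /= Nn; apply: NS => /=; lia.
- apply: (cvg_comp half _ _ gb) => S [N _ NS].
  by exists N.*2 => // n /= Nn; apply: NS => /=; lia.
Qed.

(** Strong induction on the number of terms: row [0] contributes at most [c], and the remaining rows
    satisfy the hypothesis with [c / 2] on half as many indices, so the total is
    [c + 2 * (c / 2)]. *)
Lemma sum_spread_le (w : nat -> nat -> K) (c : K) N : 0 <= c ->
  (forall j n, 0 <= w j n) ->
  (forall j M, \sum_(0 <= m < M) w j m <= c / 2 ^+ j) ->
  \sum_(0 <= n < N) spread w n <= 2 * c.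
Proof.
have [M] := ubnP N; elim: M N w c => // M IH N w c NM c0 w0 wc.
case: N NM => [|N] NM; first by rewrite big_geq// mulr_ge0.
rewrite spreadE sum_interleave.
have -> : 2 * c = c / 2 ^+ 0 + 2 * (c / 2).
  by rewrite expr0 invr1 mulr1 (mulrC c) mulrA mulfV ?pnatr_eq0// mul1r mulr_natl mulr2n.
apply: lerD; first exact: wc.
apply: IH => [||j n|j m]; [by lia|by rewrite divr_ge0|exact: w0|].
by rewrite -mulrA -invfM -exprS; exact: wc.
Qed.

Lemma seq_cvg_unique (V : normedModType K) (u : nat -> V) (a b : V) :
  u @ \oo --> a -> u @ \oo --> b -> a = b.
Proof.
move=> ua ub; have <- := norm_cvg_lim ua; exact: (norm_cvg_lim ub).
Qed.

(** The sequence equals its sequence of norms, so its limit equals its own norm. *)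
Lemma cvg_ge0 (u : nat -> K) (l : K) : (forall n, 0 <= u n) -> u @ \oo --> l -> 0 <= l.
Proof.
move=> u0 ul.
have nul : u @ \oo --> (`|l| : K).
  have <- : (fun n => `|u n|) = u by apply/funext => n; rewrite ger0_norm.
  exact: cvg_norm.
by rewrite (seq_cvg_unique ul nul).
Qed.

Lemma nonneg_series_le_lim (f : nat -> K) (l : K) N : (forall n, 0 <= f n) ->
  (fun N => \sum_(0 <= n < N) f n) @ \oo --> l -> \sum_(0 <= n < N) f n <= l.
Proof.
move=> f0 fl; rewrite -subr_ge0.
apply: (@cvg_ge0 (fun n => \sum_(0 <= k < n + N) f k - \sum_(0 <= k < N) f k)).
  move=> n; rewrite (@big_cat_nat _ _ _ N 0 (n + N))//= ?leq_addl// addrAC subrr add0r.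
  exact: sumr_ge0.
apply: cvgB; last exact: cvg_cst.
by rewrite (cvg_shiftn N (fun n => \sum_(0 <= k < n) f k)).
Qed.

End SpreadSeries.

(** * The unitization *)

Section Unitization.
Variables (R : realType) (A : completeNormedModType (Cplx R)).
Local Notation K := (Cplx R).
Variable mul : A -> A -> A.
Hypothesis HA : is_banach_algebra mul.
Implicit Types (a b : A) (x y z : A * K) (k : K).

Lemma alg_mulA : forall a b c, mul a (mul b c) = mul (mul a b) c.
Proof. by case: HA. Qed.
Lemma alg_mulPl : forall k a b c, mul (k *: a + b) c = k *: mul a c + mul b c.
Proof. by case: HA. Qed.
Lemma alg_mulPr : forall k a b c, mul a (k *: b + c) = k *: mul a b + mul a c.
Proof. by case: HA. Qed.
Lemma alg_mul_norm a b : `|mul a b| <= `|a| * `|b|.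
Proof. by case: HA. Qed.
Lemma alg_mulDl a b c : mul (a + b) c = mul a c + mul b c.
Proof. by have := alg_mulPl 1 a b c; rewrite !scale1r. Qed.
Lemma alg_mulDr a b c : mul a (b + c) = mul a b + mul a c.
Proof. by have := alg_mulPr 1 a b c; rewrite !scale1r. Qed.
Lemma alg_mul0l a : mul 0 a = 0.
Proof. by apply: (@addrI _ (mul 0 a)); rewrite -alg_mulDl !addr0. Qed.
Lemma alg_mul0r a : mul a 0 = 0.
Proof. by apply: (@addrI _ (mul a 0)); rewrite -alg_mulDr !addr0. Qed.
Lemma alg_mulZl k a b : mul (k *: a) b = k *: mul a b.
Proof. by have := alg_mulPl k a 0 b; rewrite alg_mul0l !addr0. Qed.
Lemma alg_mulZr k a b : mul a (k *: b) = k *: mul a b.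
Proof. by have := alg_mulPr k a b 0; rewrite alg_mul0r !addr0. Qed.

Lemma unorm_ge0 x : 0 <= unorm x. Proof. exact: addr_ge0. Qed.
Lemma unormZ k x : unorm (k *: x) = `|k| * unorm x.
Proof. by rewrite /unorm /= normrZ normrM mulrDr. Qed.
Lemma unorm_uemb a : unorm (uemb a) = `|a|.
Proof. by rewrite /unorm /= normr0 addr0. Qed.
Lemma unorm_uunit : unorm (uunit A) = 1.
Proof. by rewrite /unorm /= normr0 normr1 add0r. Qed.
(** The topology of [A * K] comes from the max norm, while masses and bilinear forms are measured by
    the sum norm [unorm]. Passing between the two costs the factor 2 seen in the continuity
    estimates. *)
Lemma norm_le_unorm x : `|x| <= unorm x.
Proof.
by rewrite prod_normE comparable_ge_max ?real_comparable// lerDl lerDr !normr_ge0.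
Qed.
Lemma unorm_le_norm x : unorm x <= 2 * `|x|.
Proof.
by rewrite mulr_natl mulr2n /unorm lerD// prod_normE comparable_le_max
  ?lexx ?orbT// real_comparable.
Qed.

Lemma umul_norm x y : unorm (umul mul x y) <= unorm x * unorm y.
Proof.
rewrite /unorm /umul /= mulrDl !mulrDr normrM addrA lerD2r.
apply: le_trans (ler_normD _ _) _; rewrite normrZ lerD2r.
apply: le_trans (ler_normD _ _) _; rewrite normrZ [X in _ + X]mulrC lerD2r.
exact: alg_mul_norm.
Qed.

Lemma umulPl k x y z : umul mul (k *: x + y) z = k *: umul mul x z + umul mul y z.
Proof.
case: x y z => [a s] [b t] [c r]; rewrite /umul /=; congr pair; last first.
  by rewrite /= mulrDl -scalerAl.
rewrite /= -[k *: s]/(k * s) alg_mulPl !(scalerDr, scalerDl) !scalerA (mulrC r k).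
by rewrite !addrA [LHS](ACl (1*3*5*2*4*6)).
Qed.

Lemma umulPr k x y z : umul mul x (k *: y + z) = k *: umul mul x y + umul mul x z.
Proof.
case: x y z => [a s] [b t] [c r]; rewrite /umul /=; congr pair; last first.
  by rewrite /= mulrDr -scalerAr.
rewrite /= -[k *: t]/(k * t) alg_mulPr !(scalerDr, scalerDl) !scalerA (mulrC s k).
by rewrite !addrA [LHS](ACl (1*3*5*2*4*6)).
Qed.

Lemma umulA x y z : umul mul x (umul mul y z) = umul mul (umul mul x y) z.
Proof.
case: x y z => [a s] [b t] [c r]; rewrite /umul /=; congr pair; last first.
  by rewrite /= mulrA.
rewrite /= !alg_mulDl !alg_mulDr !alg_mulZr !alg_mulZl alg_mulA.
rewrite !scalerDr !scalerA (mulrC r t) (mulrC r s) !addrA.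
by rewrite [LHS](ACl (1*3*5*2*4*6*7)).
Qed.

Lemma umul1l x : umul mul (uunit A) x = x.
Proof. by case: x => a s; rewrite /umul /= alg_mul0l scaler0 scale1r mul1r !add0r. Qed.
Lemma umul1r x : umul mul x (uunit A) = x.
Proof. by case: x => a s; rewrite /umul /= alg_mul0r scaler0 scale1r mulr1 add0r addr0. Qed.
Lemma umul_uemb a b : umul mul (uemb a) (uemb b) = uemb (mul a b).
Proof. by rewrite /umul /uemb /= !scale0r !addr0 mulr0. Qed.
Lemma uembP k a b : uemb (k *: a + b) = k *: uemb a + uemb b.
Proof. by rewrite /uemb; congr pair; rewrite /= scaler0 addr0. Qed.

End Unitization.

(** * Representations of tensors *)

Section Representations.
Variables (R : realType) (A : completeNormedModType (Cplx R)).
Local Notation K := (Cplx R).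
Local Notation AK := (A * K)%type.
Implicit Types (u v : trep A) (c : K).

(** Bounding every partial sum, not the limit, lets the estimate pass through scaling, interleaving
    and the actions without any convergence argument. *)
Definition mass_le u c := forall N, rep_mass u N <= c.

Lemma mass_term_ge0 u n : 0 <= unorm (tl u n) * unorm (tr u n).
Proof. by rewrite mulr_ge0 ?unorm_ge0. Qed.

Lemma mass_le_ge0 u c : mass_le u c -> 0 <= c.
Proof. by move=> /(_ 0%N); rewrite /rep_mass big_geq. Qed.

Lemma mass_leW u c c' : c <= c' -> mass_le u c -> mass_le u c'.
Proof. by move=> cc' uc N; exact: le_trans (uc N) cc'. Qed.

Lemma mass_leP u c : mass_le u c -> summable_rep u /\ limn (rep_mass u) <= c.
Proof.
move=> uc; have [l [ul lc _]] := bounded_nonneg_series_cvg (mass_term_ge0 u) uc.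
by split; [exists l|have -> : limn (rep_mass u) = l by exact: norm_cvg_lim].
Qed.

Lemma summable_mass_le u : summable_rep u -> mass_le u (limn (rep_mass u)).
Proof.
move=> [l ul] N; have -> : limn (rep_mass u) = l by exact: norm_cvg_lim.
exact: nonneg_series_le_lim (mass_term_ge0 u) ul.
Qed.

Lemma summable_repP u : summable_rep u <-> exists c, mass_le u c.
Proof.
split=> [/summable_mass_le|[c /mass_leP[]//]].
by exists (limn (rep_mass u)).
Qed.

Definition tinterleave u v : trep A :=
  TRep (interleave (tl u) (tl v)) (interleave (tr u) (tr v)).

Definition tscale (k : K) u : trep A := TRep (fun n => k *: tl u n) (tr u).

Definition tspread (w : nat -> trep A) : trep A :=
  TRep (spread (fun j => tl (w j))) (spread (fun j => tr (w j))).

Lemma tsubE u v : tsub u v = tinterleave u (tscale (-1) v).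
Proof.
rewrite /tsub /tinterleave /interleave /tscale /=; congr TRep.
by apply/funext => n; rewrite scaleN1r.
Qed.

Lemma tspreadE w : tspread w = tinterleave (w 0%N) (tspread (fun j => w j.+1)).
Proof. by rewrite /tspread spreadE [in X in TRep _ X]spreadE. Qed.

Lemma interleave_terms (T : Type) (P : AK -> AK -> T) u v n :
  P (tl (tinterleave u v) n) (tr (tinterleave u v) n) =
  interleave (fun n => P (tl u n) (tr u n)) (fun n => P (tl v n) (tr v n)) n.
Proof. by rewrite /= /interleave; case: odd. Qed.

Lemma mass_le_interleave u v c d :
  mass_le u c -> mass_le v d -> mass_le (tinterleave u v) (c + d).
Proof.
move=> uc vd N; rewrite /rep_mass.
under eq_bigr do rewrite (interleave_terms (fun x y => unorm x * unorm y)).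
by rewrite sum_interleave lerD//; [exact: uc|exact: vd].
Qed.

Lemma mass_le_scale k u c : mass_le u c -> mass_le (tscale k u) (`|k| * c).
Proof.
move=> uc N; rewrite /rep_mass /=; under eq_bigr do rewrite unormZ -mulrA.
by rewrite -mulr_sumr ler_wpM2l// uc.
Qed.

Lemma mass_le_sub u v c d : mass_le u c -> mass_le v d -> mass_le (tsub u v) (c + d).
Proof.
move=> uc /(mass_le_scale (-1)); rewrite normrN1 mul1r tsubE.
exact: mass_le_interleave.
Qed.

Lemma mass_le_spread w c : 0 <= c -> (forall j, mass_le (w j) (c / 2 ^+ j)) ->
  mass_le (tspread w) (2 * c).
Proof.
move=> c0 wc N; pose m j n := unorm (tl (w j) n) * unorm (tr (w j) n).
rewrite -[rep_mass _ _]/(\sum_(0 <= n < N) spread m n).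
by apply: (sum_spread_le _ c0) => j n; [exact: mass_term_ge0|exact: wc].
Qed.

(** The value at [u] of the linear map that [P] induces on the tensor product. One notion serves
    scalar forms, the product map ([tpi_is] is the case of [umul mul]) and the map [Psi]. *)
Definition tsum (V : normedModType K) (P : AK -> AK -> V) u (l : V) : Prop :=
  (fun N => \sum_(0 <= n < N) P (tl u n) (tr u n)) @ \oo --> l.

Definition bilinear_le (V : normedModType K) (P : AK -> AK -> V) (C : K) :=
  [/\ 0 <= C, forall k x y z, P (k *: x + y) z = k *: P x z + P y z,
      forall k x y z, P x (k *: y + z) = k *: P x y + P x z &
      forall x y, `|P x y| <= C * unorm x * unorm y].

(** The sign of [C] comes from evaluating the bound at the identity, where [unorm] is 1. *)
Lemma bdd_bilinear_le (B : AK -> AK -> K) :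
  bdd_bilinear B -> exists C, bilinear_le B C.
Proof.
move=> [Bl Br [C BC]]; exists C; split => //.
have := BC (uunit A) (uunit A); rewrite unorm_uunit !mulr1.
exact: le_trans.
Qed.

Section Sums.
Variable V : normedModType K.
Implicit Types (P : AK -> AK -> V) (l m : V).

Lemma tsum_unique P u l m : tsum P u l -> tsum P u m -> l = m.
Proof. exact: seq_cvg_unique. Qed.

Lemma sum_norm_bilinear_le P C u c N : bilinear_le P C -> mass_le u c ->
  \sum_(0 <= n < N) `|P (tl u n) (tr u n)| <= C * c.
Proof.
move=> [C0 _ _ PC] uc.
apply: (@le_trans _ _ (C * rep_mass u N)); last by rewrite ler_wpM2l.
rewrite /rep_mass mulr_sumr; apply: ler_sum => n _.
by rewrite mulrA; exact: PC.
Qed.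

Lemma tsum_ex P C u c : series_complete V -> bilinear_le P C -> mass_le u c ->
  exists l, tsum P u l.
Proof.
move=> cV PC uc; apply: (cV _ (C * c)) => N.
exact: sum_norm_bilinear_le.
Qed.

Lemma tsum_le P C u c l : bilinear_le P C -> mass_le u c -> tsum P u l ->
  `|l| <= C * c.
Proof.
move=> PC uc ul; apply: (cvg_norm_le ul) => N.
by apply: le_trans (ler_norm_sum _ _ _) _; exact: sum_norm_bilinear_le.
Qed.

Lemma tsum_interleave P u v l m :
  tsum P u l -> tsum P v m -> tsum P (tinterleave u v) (l + m).
Proof.
move=> ul vm; rewrite /tsum.
under eq_fun do under eq_bigr do rewrite interleave_terms.
exact: cvg_interleave.
Qed.

Lemma tsum_scale P C k u l : bilinear_le P C ->
  tsum P u l -> tsum P (tscale k u) (k *: l).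
Proof.
move=> [_ Pl _ _] ul; rewrite /tsum /=.
have P0 z : P 0 z = 0.
  by apply: (@addrI _ (P 0 z)); have := Pl 1 0 0 z; rewrite !scale1r !addr0.
have PZ x z : P (k *: x) z = k *: P x z.
  by have := Pl k x 0 z; rewrite P0 !addr0.
under eq_fun do under eq_bigr do rewrite PZ.
by under eq_fun do rewrite -scaler_sumr; exact: cvgZl_tmp.
Qed.

Lemma tsum_sub P C u v l m : bilinear_le P C ->
  tsum P u l -> tsum P v m -> tsum P (tsub u v) (l - m).
Proof.
move=> PC ul vm; rewrite tsubE -(scaleN1r m).
exact: (tsum_interleave ul (tsum_scale (k := -1) PC vm)).
Qed.

End Sums.

Section Actions.
Variable mul : A -> A -> A.
Hypothesis HA : is_banach_algebra mul.

Lemma mass_le_lact a u c : mass_le u c -> mass_le (tlact mul a u) (`|a| * c).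
Proof.
move=> uc N; apply: (@le_trans _ _ (`|a| * rep_mass u N)); last by rewrite ler_wpM2l.
rewrite /rep_mass mulr_sumr; apply: ler_sum => n _; rewrite mulrA ler_wpM2r ?unorm_ge0//.
by rewrite -unorm_uemb; exact: umul_norm.
Qed.

Lemma mass_le_ract a u c : mass_le u c -> mass_le (tract mul u a) (`|a| * c).
Proof.
move=> uc N; apply: (@le_trans _ _ (`|a| * rep_mass u N)); last by rewrite ler_wpM2l.
rewrite /rep_mass mulr_sumr; apply: ler_sum => n _; rewrite mulrCA ler_wpM2l ?unorm_ge0//.
by rewrite -unorm_uemb mulrC; exact: umul_norm.
Qed.

Lemma bilinear_le_umul : bilinear_le (umul mul : AK -> AK -> AK) 1.
Proof.
split => //; [exact: umulPl|exact: umulPr|move=> x y].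
by rewrite mul1r; apply: le_trans (norm_le_unorm _) _; exact: umul_norm.
Qed.

Lemma bilinear_le_lact (V : normedModType K) (P : AK -> AK -> V) C a :
  bilinear_le P C -> bilinear_le (fun x y => P (umul mul (uemb a) x) y) (C * `|a|).
Proof.
move=> [C0 Pl Pr PC]; split=> [|k x y z|k x y z|x y].
- by rewrite mulr_ge0.
- by rewrite umulPr.
- exact: Pr.
- apply: le_trans (PC _ _) _; rewrite ler_wpM2r ?unorm_ge0// -mulrA ler_wpM2l//.
  by rewrite -unorm_uemb; exact: umul_norm.
Qed.

Lemma bilinear_le_ract (V : normedModType K) (P : AK -> AK -> V) C a :
  bilinear_le P C -> bilinear_le (fun x y => P x (umul mul y (uemb a))) (C * `|a|).
Proof.
move=> [C0 Pl Pr PC]; split=> [|k x y z|k x y z|x y].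
- by rewrite mulr_ge0.
- exact: Pl.
- by rewrite umulPl.
- apply: le_trans (PC _ _) _.
  rewrite [leRHS](_ : _ = C * unorm x * (unorm y * `|a|)); last first.
    by rewrite -!mulrA; congr (_ * _); rewrite mulrCA [X in _ * X]mulrC.
  rewrite ler_wpM2l ?mulr_ge0 ?unorm_ge0//.
  by rewrite -unorm_uemb; exact: umul_norm.
Qed.

End Actions.
End Representations.

(** * From nets to derivations *)

Section ProjectiveNorm.
Variables (R : realType) (A : completeNormedModType (Cplx R)).
Local Notation K := (Cplx R).
Local Notation AK := (A * K)%type.

(** A bounded functional commutes with the sum, which turns a vector-valued [P] into a scalar form
    that [trep_eq] can test. *)
Lemma tsum_functional (V : normedModType K) (P : AK -> AK -> V) C
    (f : V -> K) (D : K) u l :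
  0 <= D -> (forall k x z, f (k *: x + z) = k * f x + f z) ->
  (forall x, `|f x| <= D * `|x|) -> bilinear_le P C -> tsum P u l ->
  bdd_bilinear (fun x y => f (P x y)) /\
  limn (rep_eval (fun x y => f (P x y)) u) = f l.
Proof.
move=> D0 flin fD [C0 Pl Pr PC] ul; split.
  split=> [k x y z|k x y z|]; first by rewrite Pl flin.
    by rewrite Pr flin.
  exists (D * C) => x y; apply: le_trans (fD _) _.
  by rewrite -!mulrA ler_wpM2l// mulrA.
have fD' x z : f (x + z) = f x + f z by have := flin 1 x z; rewrite scale1r mul1r.
have f0 : f 0 = 0 by apply: (@addrI _ (f 0)); rewrite -fD' !addr0.
have fB x z : f (x - z) = f x - f z.
  by rewrite addrC -scaleN1r flin mulN1r addrC.
have := cvg_bounded_additive D0 fB fD ul.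
under eq_fun do rewrite (big_morph f fD' f0).
exact: norm_cvg_lim.
Qed.

Lemma trep_eq_tsum (V : normedModType K) (P : AK -> AK -> V) C u v l m :
  bilinear_le P C -> trep_eq u v -> tsum P u l -> tsum P v m -> l = m.
Proof.
move=> PC uv ul vm; apply/eqP; rewrite -subr_eq0; apply: contrapT => lm.
have [|f [flin f2 flm]] := @normed_separation R V (l - m); first exact/eqP/negP.
have [Bf fu] := tsum_functional (ler0n _ 2) flin f2 PC ul.
have [_ fv] := tsum_functional (ler0n _ 2) flin f2 PC vm.
apply: flm; have := uv _ Bf; rewrite fu fv => flm.
by rewrite addrC -scaleN1r flin mulN1r flm addNr.
Qed.

(** The sum depends only on the tensor, so it may be computed on a representation whose mass is
    within [e / (C + 1)] of [c]. *)
Lemma tnorm_le_tsum (V : normedModType K) (P : AK -> AK -> V) C u c l :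
  series_complete V -> bilinear_le P C -> tnorm_le u c -> tsum P u l ->
  `|l| <= C * c.
Proof.
move=> cV PC uc ul; apply/ler_addgt0Pr => e e0.
have C0 : 0 <= C by case: PC.
have C1 : 0 < C + 1 by rewrite ltr_wpDl.
have [v [/summable_mass_le vm uv vc]] := uc _ (divr_gt0 e0 C1).
have {vm}vm := mass_leW vc vm.
have [m Pm] := tsum_ex cV PC vm.
rewrite (trep_eq_tsum PC uv ul Pm); apply: le_trans (tsum_le PC vm Pm) _.
rewrite mulrDr lerD2l mulrCA -[leRHS]mulr1 ler_wpM2l ?(ltW e0)//.
by rewrite ler_pdivrMr// mul1r lerDl.
Qed.

End ProjectiveNorm.

Lemma continuous_linear_norm_le (K : numFieldType) (V W : normedModType K)
    (f : V -> W) : (forall k x y, f (k *: x + y) = k *: f x + f y) ->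
  continuous f -> exists2 M, 0 < M & forall x, `|f x| <= M * `|x|.
Proof.
move=> flin fc.
have f0 : f 0 = 0.
  by apply: (@addrI _ (f 0)); have := flin 1 0 0; rewrite !scale1r !addr0.
have fZ k x : f (k *: x) = k *: f x by have := flin k x 0; rewrite f0 !addr0.
have /cvgrPdist_lt /(_ 1 ltr01) := fc 0.
rewrite f0 => /nbhs_norm0P[d /= d0 df].
(* A nonzero [x] is rescaled to norm [d / 2], inside the ball where [f] has norm less than 1. *)
exists (2 / d) => [|x]; first by rewrite divr_gt0.
have [->|x0] := eqVneq x 0; first by rewrite f0 !normr0 mulr0.
have nx : 0 < `|x| by rewrite normr_gt0.
have [s s0 sE] : exists2 s : K, 0 < s & s * `|x| = d / 2.
  exists (d / 2 / `|x|); first by rewrite !divr_gt0.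
  by rewrite divfK ?gt_eqF.
have := df (s *: x); rewrite /= sub0r normrN fZ !normrZ (gtr0_norm s0) sE.
rewrite ltr_pdivrMr// mulr_natr mulr2n ltrDl => /(_ d0) /ltW fx.
rewrite -(ler_pM2l s0) mulrCA sE; apply: le_trans fx _.
by rewrite mulrA mulfVK ?gt_eqF// mulfV// pnatr_eq0.
Qed.

Section Sufficiency.
Variables (R : realType) (A : completeNormedModType (Cplx R)).
Local Notation K := (Cplx R).
Local Notation AK := (A * K)%type.
Variable mul : A -> A -> A.
Variables (Y : completeNormedModType K) (lact : A -> Y -> Y) (ract : Y -> A -> Y).
Hypothesis HY : is_banach_bimodule mul lact ract.
Variable D : A -> Y.
Hypotheses (HD : is_derivation mul lact ract D) (Dcont : continuous D).

Definition luact (x : AK) (y : Y) : Y := lact x.1 y + x.2 *: y.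

Let lactPl k a b y : lact (k *: a + b) y = k *: lact a y + lact b y.
Proof. by case: HY. Qed.
Let lactPr k a y z : lact a (k *: y + z) = k *: lact a y + lact a z.
Proof. by case: HY => _ []. Qed.
Let ractPl k y z a : ract (k *: y + z) a = k *: ract y a + ract z a.
Proof. by case: HY => _ [_ []]. Qed.
Let lactM a b y : lact (mul a b) y = lact a (lact b y).
Proof. by case: HY => _ [_ [_ [_ []]]]. Qed.
Let lractA a y b : ract (lact a y) b = lact a (ract y b).
Proof. by case: HY => _ [_ [_ [_ [_ [_ []]]]]]. Qed.
Let act_norm : exists C : K, 0 < C /\ forall a y,
  `|lact a y| <= C * `|a| * `|y| /\ `|ract y a| <= C * `|a| * `|y|.
Proof. by case: HY => _ [_ [_ [_ [_ [_ [_ ]]]]]]. Qed.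
Let DP k a b : D (k *: a + b) = k *: D a + D b. Proof. by case: HD. Qed.
Let DM a b : D (mul a b) = lact a (D b) + ract (D a) b.
Proof. by case: HD. Qed.

Let lactDr a y z : lact a (y + z) = lact a y + lact a z.
Proof. by have := lactPr 1 a y z; rewrite !scale1r. Qed.
Let lact0r a : lact a 0 = 0.
Proof. by apply: (@addrI _ (lact a 0)); rewrite -lactDr !addr0. Qed.
Let lactZr k a y : lact a (k *: y) = k *: lact a y.
Proof. by have := lactPr k a y 0; rewrite lact0r !addr0. Qed.
Let lactDl a b y : lact (a + b) y = lact a y + lact b y.
Proof. by have := lactPl 1 a b y; rewrite !scale1r. Qed.
Let lact0l y : lact 0 y = 0.
Proof. by apply: (@addrI _ (lact 0 y)); rewrite -lactDl !addr0. Qed.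
Let lactZl k a y : lact (k *: a) y = k *: lact a y.
Proof. by have := lactPl k a 0 y; rewrite lact0l !addr0. Qed.
Let ractDl y z a : ract (y + z) a = ract y a + ract z a.
Proof. by have := ractPl 1 y z a; rewrite !scale1r. Qed.
Let ract0l a : ract 0 a = 0.
Proof. by apply: (@addrI _ (ract 0 a)); rewrite -ractDl !addr0. Qed.
Let ractZl k y a : ract (k *: y) a = k *: ract y a.
Proof. by have := ractPl k y 0 a; rewrite ract0l !addr0. Qed.
Let DD a b : D (a + b) = D a + D b.
Proof. by have := DP 1 a b; rewrite !scale1r. Qed.
Let D0 : D 0 = 0. Proof. by apply: (@addrI _ (D 0)); rewrite -DD !addr0. Qed.
Let DZ k a : D (k *: a) = k *: D a.
Proof. by have := DP k a 0; rewrite D0 !addr0. Qed.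

Lemma luactPl k x y z : luact (k *: x + y) z = k *: luact x z + luact y z.
Proof.
rewrite /luact /= -[k *: x.2]/(k * x.2) lactPl scalerDl !scalerDr scalerA.
by rewrite addrACA.
Qed.

Lemma luactPr k x y z : luact x (k *: y + z) = k *: luact x y + luact x z.
Proof.
by rewrite /luact lactPr !scalerDr !scalerA (mulrC x.2) addrACA.
Qed.

Lemma luactM x y z : luact (umul mul x y) z = luact x (luact y z).
Proof.
rewrite /luact /umul /= !(lactDl, lactDr, lactM, lactZl, lactZr) scalerDr scalerA.
by rewrite !addrA.
Qed.

Lemma luact_norm : exists2 C, 0 <= C & forall x y, `|luact x y| <= C * unorm x * `|y|.
Proof.
have [C [C0 HC]] := act_norm; exists (C + 1) => [|x y]; first by rewrite addr_ge0 ?ltW.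
apply: le_trans (ler_normD _ _) _; rewrite normrZ.
apply: le_trans (lerD (HC x.1 y).1 (lexx _)) _.
rewrite -mulrDl ler_wpM2r// mulrDl mul1r.
by apply: lerD; [rewrite ler_wpM2l ?(ltW C0)// lerDl|rewrite lerDr].
Qed.

(* [D] is extended to the unitization by [D e = 0]. *)
Definition derivation_pairing (x z : AK) : Y := luact x (D z.1).

Lemma derivation_pairing_le : exists C, bilinear_le derivation_pairing C.
Proof.
have [C C0 HC] := luact_norm.
have [M M0 DM0] := continuous_linear_norm_le DP Dcont.
exists (C * M); split=> [|k x y z|k x y z|x z].
- by rewrite mulr_ge0// ltW.
- exact: luactPl.
- by rewrite /derivation_pairing /= DP luactPr.
- apply: le_trans (HC _ _) _; rewrite (mulrAC C M) -(mulrA _ M).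
  rewrite ler_wpM2l ?mulr_ge0 ?unorm_ge0//; apply: le_trans (DM0 _) _.
  by rewrite ler_wpM2l ?(ltW M0)// lerDl.
Qed.

Lemma derivation_pairing_lact a x z :
  derivation_pairing (umul mul (uemb a) x) z = lact a (derivation_pairing x z).
Proof.
rewrite /derivation_pairing luactM {1}/luact /= scale0r addr0 //.
Qed.

(** Leibniz rule in the unitization: [b . D (c a) = (b c) . D a + (b . D c) . a]. Summed over a
    representation, the first term becomes the product of the tensor acting on [D a]. *)
Lemma derivation_pairing_ract a x z :
  derivation_pairing x (umul mul z (uemb a)) =
  luact (umul mul x z) (D a) + ract (derivation_pairing x z) a.
Proof.
rewrite luactM /derivation_pairing /umul /= scale0r addr0 DD DM DZ /luact.
rewrite !(lactDr, lactZr, ractDl, ractZl, scalerDr) lractA.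
by rewrite !addrA [LHS](ACl (1*3*4*6*2*5)).
Qed.

Lemma lactB a y z : lact a (y - z) = lact a y - lact a z.
Proof. by rewrite lactDr -scaleN1r lactZr scaleN1r. Qed.

Lemma ractB a y z : ract (y - z) a = ract y a - ract z a.
Proof. by rewrite ractDl -scaleN1r ractZl scaleN1r. Qed.

Lemma luactB y x z : luact (x - z) y = luact x y - luact z y.
Proof. by rewrite addrC -scaleN1r luactPl scaleN1r addrC. Qed.

Lemma tsum_lact a u l :
  tsum derivation_pairing u l -> tsum derivation_pairing (tlact mul a u) (lact a l).
Proof.
move=> ul; have [C [C0 HC]] := act_norm.
have := cvg_bounded_additive (mulr_ge0 (ltW C0) (normr_ge0 a))
  (lactB a) (fun y => (HC a y).1) ul.
rewrite /tsum; under eq_fun do rewrite (big_morph _ (lactDr a) (lact0r a)).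
by under [in X in _ -> X]eq_fun do under eq_bigr do rewrite derivation_pairing_lact.
Qed.

Lemma tsum_ract a u l : tpi_is mul u (uunit A) ->
  tsum derivation_pairing u l ->
  tsum derivation_pairing (tract mul u a) (D a + ract l a).
Proof.
move=> upi ul; rewrite /tsum.
under eq_fun do under eq_bigr do rewrite derivation_pairing_ract.
under eq_fun do rewrite big_split /=.
have [C [C0 HC]] := act_norm; have [E E0 HE] := luact_norm.
apply: cvgD.
- have HE' (x : AK) : `|luact x (D a)| <= E * 2 * `|D a| * `|x|.
    apply: le_trans (HE _ _) _; rewrite (mulrAC _ `|D a| `|x|) -(mulrA E 2).
    by rewrite ler_wpM2r// ler_wpM2l// unorm_le_norm.
  (* Read as [e . D a], the limit is the image of the product [e] of [u] under the continuous map
     [x |-> x . D a]. *)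
  have -> : D a = luact (uunit A) (D a) by rewrite /luact lact0l scale1r add0r.
  have E2 : 0 <= E * 2 * `|D a| by rewrite !mulr_ge0.
  have := cvg_bounded_additive E2 (luactB (D a)) HE' upi.
  have lD x y : luact (x + y) (D a) = luact x (D a) + luact y (D a).
    by have := luactPl 1 x y (D a); rewrite !scale1r.
  have l0 : luact 0 (D a) = 0 by rewrite /luact lact0l scale0r addr0.
  under eq_fun do rewrite (big_morph (luact^~ (D a)) lD l0).
  by rewrite /luact lact0l scale1r add0r.
- have := cvg_bounded_additive (mulr_ge0 (ltW C0) (normr_ge0 a))
    (ractB a) (fun y => (HC a y).2) ul.
  by under eq_fun do rewrite (big_morph (ract^~ a) (fun y z => ractDl y z a) (ract0l a)).
Qed.

Lemma bdd_approx_semi_inner_of_nets (Kc : K) (I : Type) (le : I -> I -> Prop)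
    (xi eta : I -> trep A) :
  0 < Kc -> directed le -> (forall i, summable_rep (xi i) /\ summable_rep (eta i)) ->
  (forall a : A, forall e : K, 0 < e -> exists i0, forall i, le i0 i ->
     tnorm_le (tsub (tlact mul a (xi i)) (tract mul (eta i) a)) e) ->
  (forall i (a : A),
     tnorm_le (tsub (tlact mul a (xi i)) (tract mul (eta i) a)) (Kc * `|a|)) ->
  (forall i, tpi_is mul (eta i) (uunit A)) ->
  bdd_approx_semi_inner lact ract D.
Proof.
move=> Kc0 dle sum cvg0 bnd pi1.
have [C PC] := derivation_pairing_le; have C0 : 0 <= C by case: PC.
have [M M0 HM] := continuous_linear_norm_le DP Dcont.
have ex u : summable_rep u -> exists l, tsum derivation_pairing u l.
  move=> /summable_mass_le uc.
  exact: tsum_ex (@series_complete_complete R Y) PC uc.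
have [x Hx] := choice (fun i => ex _ (sum i).1).
have [y Hy] := choice (fun i => ex _ (sum i).2).
(* The left side is the norm of [Psi] at [a xi_i - eta_i a]. Small projective norms give the
   convergence, and bounded ones the uniform bound. *)
have est i a c : tnorm_le (tsub (tlact mul a (xi i)) (tract mul (eta i) a)) c ->
    `|lact a (x i) - ract (y i) a - D a| <= C * c.
  move=> ac; rewrite -addrA -opprD (addrC _ (D a)).
  apply: (tnorm_le_tsum (@series_complete_complete R Y) PC ac).
  apply: tsum_sub PC _ _; first exact: tsum_lact.
  exact: tsum_ract.
(* [C * Kc] bounds the distance from the approximants to [D], and [M] bounds [D] itself. *)
exists (C * Kc + M); split; first by rewrite ltr_wpDl// mulr_ge0// ltW.
exists I, le, x, y; split => // [a e e0|i a].
- have C1 : 0 < C + 1 by rewrite ltr_wpDl.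
  have [i0 Hi0] := cvg0 a _ (divr_gt0 e0 C1); exists i0 => i /Hi0/est.
  move=> /le_lt_trans; apply.
  by rewrite mulrCA -[ltRHS]mulr1 ltr_pM2l// ltr_pdivrMr// mul1r ltrDl.
- rewrite -(subrK (D a) (_ - _)) mulrDl; apply: le_trans (ler_normD _ _) _.
  by apply: lerD; [rewrite -mulrA; exact/est|exact: HM].
Qed.

End Sufficiency.

(** * The kernel of the product map as a Banach bimodule *)

Section Evaluation.
Variables (R : realType) (A : completeNormedModType (Cplx R)).
Local Notation K := (Cplx R).
Local Notation AK := (A * K)%type.
Implicit Types (u v : trep A) (c : K) (B : AK -> AK -> K).

(* The value 0 on other forms makes equality of these functionals coincide with
   [trep_eq]. *)
Definition tensor_eval u : (AK -> AK -> K) -> K^o :=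
  fun B => if pselect (bdd_bilinear B) then limn (rep_eval B u) else 0.

Lemma tensor_evalE u B (l : K) : bdd_bilinear B -> tsum B u l -> tensor_eval u B = l.
Proof.
by move=> HB ul; rewrite /tensor_eval; case: pselect => // ?; exact: norm_cvg_lim ul.
Qed.

Lemma tensor_eval_out u B : ~ bdd_bilinear B -> tensor_eval u B = 0.
Proof. by move=> HB; rewrite /tensor_eval; case: pselect. Qed.

Lemma tensor_evalP u c B : mass_le u c -> bdd_bilinear B ->
  tsum B u (tensor_eval u B).
Proof.
move=> uc HB; have [C BC] := bdd_bilinear_le HB.
have [l ul] := tsum_ex (@series_complete_Cplx R) BC uc.
by rewrite (tensor_evalE HB ul).
Qed.

Lemma tensor_eval_ext u (phi : (AK -> AK -> K) -> K^o) :
  (forall B, bdd_bilinear B -> tsum B u (phi B)) ->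
  (forall B, ~ bdd_bilinear B -> phi B = 0) -> tensor_eval u = phi.
Proof.
move=> Hin Hout; apply/funext => B; have [HB|HB] := pselect (bdd_bilinear B).
  exact: tensor_evalE (Hin B HB).
by rewrite tensor_eval_out// Hout.
Qed.

Lemma tensor_eval_trep_eq u v : tensor_eval u = tensor_eval v -> trep_eq u v.
Proof.
move=> uv B HB; have := congr1 (@^~ B) uv.
by rewrite /tensor_eval; case: pselect.
Qed.

Lemma tensor_eval_interleave u v c d : mass_le u c -> mass_le v d ->
  tensor_eval (tinterleave u v) = tensor_eval u + tensor_eval v.
Proof.
move=> uc vd; apply: tensor_eval_ext => B HB.
  exact: tsum_interleave (tensor_evalP uc HB) (tensor_evalP vd HB).
by rewrite fctE !tensor_eval_out// addr0.
Qed.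

Lemma tensor_eval_scale k u c : mass_le u c ->
  tensor_eval (tscale k u) = k *: tensor_eval u.
Proof.
move=> uc; apply: tensor_eval_ext => B HB.
  have [C BC] := bdd_bilinear_le HB.
  exact: tsum_scale BC (tensor_evalP uc HB).
by rewrite fctE !tensor_eval_out// scaler0.
Qed.

Lemma tensor_eval_sub u v c d : mass_le u c -> mass_le v d ->
  tensor_eval (tsub u v) = tensor_eval u - tensor_eval v.
Proof.
move=> uc vd; rewrite tsubE (tensor_eval_interleave uc (mass_le_scale (-1) vd)).
by rewrite (tensor_eval_scale _ vd) scaleN1r.
Qed.

Definition tzero : trep A := TRep (fun=> 0) (fun=> 0).

Lemma mass_le_zero : mass_le tzero 0.
Proof.
by move=> N; rewrite /rep_mass big1// => n _; rewrite /= /unorm /= !normr0 addr0 mulr0.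
Qed.

Lemma bilinear_le0 (V : normedModType K) (P : AK -> AK -> V) C z :
  bilinear_le P C -> P 0 z = 0.
Proof.
move=> [_ Pl _ _]; apply: (@addrI _ (P 0 z)).
by have := Pl 1 0 0 z; rewrite !scale1r !addr0.
Qed.

Lemma tsum_zero (V : normedModType K) (P : AK -> AK -> V) C :
  bilinear_le P C -> tsum P tzero 0.
Proof.
move=> PC; rewrite /tsum; under eq_fun do under eq_bigr do rewrite (bilinear_le0 _ PC).
by under eq_fun do rewrite big1//; exact: cvg_cst.
Qed.

Lemma tensor_eval_zero : tensor_eval tzero = 0.
Proof.
apply: tensor_eval_ext => // B HB; have [C BC] := bdd_bilinear_le HB.
exact: tsum_zero BC.
Qed.

Definition tunit : trep A :=
  TRep (fun n => if n is 0 then uunit A else 0) (fun n => if n is 0 then uunit A else 0).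

Lemma tsum_unit (V : normedModType K) (P : AK -> AK -> V) C :
  bilinear_le P C -> tsum P tunit (P (uunit A) (uunit A)).
Proof.
move=> PC; rewrite /tsum -(cvg_shiftn 1).
have -> : (fun n => \sum_(0 <= k < n + 1) P (tl tunit k) (tr tunit k)) =
  fun=> P (uunit A) (uunit A); last exact: cvg_cst.
apply/funext => n; rewrite addn1 big_nat_recl//= big1 ?addr0// => k _.
exact: bilinear_le0 PC.
Qed.

Lemma mass_le_unit : mass_le tunit 1.
Proof.
move=> [|N]; rewrite /rep_mass; first by rewrite big_geq.
rewrite big_nat_recl//= big1 ?addr0 ?unorm_uunit ?mulr1// => k _.
by rewrite /unorm /= !normr0 addr0 mulr0.
Qed.

End Evaluation.

Section TensorActions.
Variables (R : realType) (A : completeNormedModType (Cplx R)).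
Local Notation K := (Cplx R).
Local Notation AK := (A * K)%type.
Variable mul : A -> A -> A.
Hypothesis HA : is_banach_algebra mul.
Implicit Types (u v : trep A) (c : K) (B : AK -> AK -> K) (a b : A).

Lemma tpi_lact a u s : tpi_is mul u s -> tpi_is mul (tlact mul a u) (umul mul (uemb a) s).
Proof.
move=> us; pose g := umul mul (uemb a).
have gD x y : g (x + y) = g x + g y.
  by have := umulPr HA 1 (uemb a) x y; rewrite !scale1r.
have g0 : g 0 = 0 by apply: (@addrI _ (g 0)); rewrite -gD !addr0.
have gB x y : g (x - y) = g x - g y.
  by rewrite addrC -scaleN1r /g umulPr// scaleN1r addrC.
have gn x : `|g x| <= `|a| * 2 * `|x|.
  apply: le_trans (norm_le_unorm _) _; apply: le_trans (umul_norm HA _ _) _.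
  by rewrite unorm_uemb -mulrA ler_wpM2l// unorm_le_norm.
have a2 : 0 <= `|a| * 2 by rewrite mulr_ge0.
have := cvg_bounded_additive a2 gB gn us.
under eq_fun do rewrite (big_morph g gD g0).
rewrite /tpi_is; under [in X in _ -> X]eq_fun do under eq_bigr do rewrite -umulA//.
exact.
Qed.

Lemma tpi_ract a u s : tpi_is mul u s -> tpi_is mul (tract mul u a) (umul mul s (uemb a)).
Proof.
move=> us; pose g x := umul mul x (uemb a).
have gD x y : g (x + y) = g x + g y.
  by have := umulPl HA 1 x y (uemb a); rewrite !scale1r.
have g0 : g 0 = 0 by apply: (@addrI _ (g 0)); rewrite -gD !addr0.
have gB x y : g (x - y) = g x - g y.
  by rewrite addrC -scaleN1r /g umulPl// scaleN1r addrC.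
have gn x : `|g x| <= `|a| * 2 * `|x|.
  apply: le_trans (norm_le_unorm _) _; apply: le_trans (umul_norm HA _ _) _.
  by rewrite unorm_uemb mulrC -mulrA ler_wpM2l// unorm_le_norm.
have a2 : 0 <= `|a| * 2 by rewrite mulr_ge0.
have := cvg_bounded_additive a2 gB gn us.
under eq_fun do rewrite (big_morph g gD g0).
rewrite /tpi_is; under [in X in _ -> X]eq_fun do under eq_bigr do rewrite umulA//.
exact.
Qed.

Lemma bdd_bilinear_lact a B :
  bdd_bilinear B -> bdd_bilinear (fun x y => B (umul mul (uemb a) x) y).
Proof.
move=> /bdd_bilinear_le[C /(bilinear_le_lact HA a)[_ Bl Br BC]].
by split=> //; exists (C * `|a|).
Qed.

Lemma bdd_bilinear_ract a B :
  bdd_bilinear B -> bdd_bilinear (fun x y => B x (umul mul y (uemb a))).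
Proof.
move=> /bdd_bilinear_le[C /(bilinear_le_ract HA a)[_ Bl Br BC]].
by split=> //; exists (C * `|a|).
Qed.

Lemma tensor_eval_lact a u c B : mass_le u c -> bdd_bilinear B ->
  tensor_eval (tlact mul a u) B = tensor_eval u (fun x y => B (umul mul (uemb a) x) y).
Proof.
move=> uc HB; apply: (tensor_evalE HB).
exact: (tensor_evalP uc (bdd_bilinear_lact a HB)).
Qed.

Lemma tensor_eval_ract a u c B : mass_le u c -> bdd_bilinear B ->
  tensor_eval (tract mul u a) B = tensor_eval u (fun x y => B x (umul mul y (uemb a))).
Proof.
move=> uc HB; apply: (tensor_evalE HB).
exact: (tensor_evalP uc (bdd_bilinear_ract a HB)).
Qed.

End TensorActions.

(** * The kernel as a normed space *)

Section KernelSpace.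
Variables (R : realType) (A : completeNormedModType (Cplx R)).
Local Notation K := (Cplx R).
Local Notation AK := (A * K)%type.
Local Notation functional := ((AK -> AK -> K) -> K^o).
Variable mul : A -> A -> A.
Implicit Types (u v : trep A) (c : K) (phi : functional).

(** The condition on the product sits on the representation, so each functional of the kernel comes
    with a witness on which sums, actions and tails operate termwise. *)
Definition ker_rep u phi c :=
  [/\ mass_le u c, tpi_is mul u 0 & tensor_eval u = phi].

(* The proof argument makes the closure properties below available to
   canonical structure inference. *)
Definition ker_fun of is_banach_algebra mul : {pred functional} :=
  fun phi => `[< exists u c, ker_rep u phi c >].

Lemma ker_rep_scale k u phi c : is_banach_algebra mul ->
  ker_rep u phi c -> ker_rep (tscale k u) (k *: phi) (`|k| * c).
Proof.
move=> HA [uc upi <-]; split; first exact: mass_le_scale.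
  by have := tsum_scale (k := k) (bilinear_le_umul HA) upi; rewrite scaler0.
exact: tensor_eval_scale uc.
Qed.

Lemma ker_rep_add u v phi psi c d : ker_rep u phi c -> ker_rep v psi d ->
  ker_rep (tinterleave u v) (phi + psi) (c + d).
Proof.
move=> [uc upi <-] [vd vpi <-]; split; first exact: mass_le_interleave.
  by have := tsum_interleave upi vpi; rewrite addr0.
exact: tensor_eval_interleave uc vd.
Qed.

Lemma ker_rep_zero : is_banach_algebra mul -> ker_rep (tzero A) 0 0.
Proof.
move=> HA; split; [exact: mass_le_zero| |exact: tensor_eval_zero].
exact: tsum_zero (bilinear_le_umul HA).
Qed.

Variable HA : is_banach_algebra mul.

Lemma ker_fun_submod : submod_closed (ker_fun HA).
Proof.
split=> [|k phi psi /asboolP[u [c uc]] /asboolP[v [d vd]]]; apply/asboolP.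
  by exists (tzero A), 0; exact: ker_rep_zero.
exists (tinterleave (tscale k u) v), (`|k| * c + d).
exact: ker_rep_add (ker_rep_scale k HA uc) vd.
Qed.

HB.instance Definition _ :=
  GRing.isSubmodClosed.Build K functional (ker_fun HA) ker_fun_submod.

Record kerpi := Kerpi { kerpi_val : functional; _ : kerpi_val \in ker_fun HA }.

HB.instance Definition _ := [isSub for kerpi_val].
HB.instance Definition _ := [Choice of kerpi by <:].
HB.instance Definition _ := [SubChoice_isSubLmodule of kerpi by <:].
Implicit Types x y : kerpi.

Lemma kerpi_repP x : exists u c, ker_rep u (val x) c.
Proof. by case: x => phi /= /asboolP. Qed.

(** The masses are collected as real numbers because the infimum needs a total order. *)
Definition masses x : set R := [set r | exists u, ker_rep u (val x) (toC r)].

Lemma ker_rep_ge0 u phi c : ker_rep u phi c -> 0 <= c.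
Proof. by case=> /mass_le_ge0. Qed.

Lemma masses_lbound x : lbound (masses x) 0.
Proof. by move=> r [u /ker_rep_ge0]; rewrite -toC0 ler_toC. Qed.

Lemma masses_has_inf x : has_inf (masses x).
Proof.
split; last by exists 0; exact: masses_lbound.
have [u [c uc]] := kerpi_repP x; exists (fromC c), u.
by rewrite fromCK// (ker_rep_ge0 uc).
Qed.

Definition kerpi_norm x : K := toC (inf (masses x)).

Lemma kerpi_norm_ge0 x : 0 <= kerpi_norm x.
Proof.
rewrite -toC0 ler_toC; apply: lb_le_inf; last exact: masses_lbound.
by case: (masses_has_inf x).
Qed.

Lemma kerpi_norm_le x u c : ker_rep u (val x) c -> kerpi_norm x <= c.
Proof.
move=> uc; have c0 := ker_rep_ge0 uc; rewrite -(fromCK c0) ler_toC.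
apply: ge_inf; first by exists 0; exact: masses_lbound.
by exists u; rewrite fromCK.
Qed.

Lemma ker_repW u phi c d : c <= d -> ker_rep u phi c -> ker_rep u phi d.
Proof. by move=> cd [uc upi uphi]; split => //; exact: mass_leW cd uc. Qed.

Lemma kerpi_norm_lt x c : kerpi_norm x < c -> exists u, ker_rep u (val x) c.
Proof.
move=> xc; have c0 : 0 <= c := le_trans (kerpi_norm_ge0 x) (ltW xc).
move: xc; rewrite -(fromCK c0) ltr_toC => /(inf_lt (masses_has_inf x).1)[r [u ur] rc].
by exists u; apply: ker_repW ur; rewrite ler_toC ltW.
Qed.

Lemma kerpi_norm_approx x e : 0 < e -> exists u, ker_rep u (val x) (kerpi_norm x + e).
Proof. by move=> e0; apply: kerpi_norm_lt; rewrite ltrDl. Qed.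

Lemma kerpi_normD x y : kerpi_norm (x + y) <= kerpi_norm x + kerpi_norm y.
Proof.
apply/ler_addgt0Pr => e e0; have e2 : 0 < e / 2 by rewrite divr_gt0.
have [u ux] := kerpi_norm_approx x e2; have [v vy] := kerpi_norm_approx y e2.
have := ker_rep_add ux vy; rewrite addrACA -splitr.
exact: (@kerpi_norm_le (x + y)).
Qed.

Lemma kerpi_normZ_le k x : kerpi_norm (k *: x) <= `|k| * kerpi_norm x.
Proof.
apply/ler_addgt0Pr => e e0.
have k1 : 0 < `|k| + 1 by rewrite ltr_wpDl.
have [u ux] := kerpi_norm_approx x (divr_gt0 e0 k1).
apply: le_trans (@kerpi_norm_le (k *: x) _ _ (ker_rep_scale k HA ux)) _.
rewrite mulrDr lerD2l mulrCA -[leRHS]mulr1 ler_wpM2l ?(ltW e0)//.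
by rewrite ler_pdivrMr// mul1r lerDl.
Qed.

Lemma kerpi_normZ k x : kerpi_norm (k *: x) = `|k| * kerpi_norm x.
Proof.
apply/eqP; rewrite eq_le kerpi_normZ_le /=.
have [->|k0] := eqVneq k 0; first by rewrite normr0 mul0r kerpi_norm_ge0.
(* The reverse inequality is [kerpi_normZ_le] for the scalar [k^-1] and the vector [k *: x]. *)
rewrite -[in leLHS](scalerK k0 x).
apply: le_trans (ler_wpM2l (normr_ge0 _) (kerpi_normZ_le _ _)) _.
by rewrite mulrA -normrM divff// normr1 mul1r.
Qed.

(** The value at a form with constant [C] is at most [C] times the mass of any representation, and
    these masses can be taken arbitrarily small. *)
Lemma kerpi_norm0_eq0 x : kerpi_norm x = 0 -> x = 0.
Proof.
move=> x0; apply: val_inj; apply/funext => B /=.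
have [HB|HB] := pselect (bdd_bilinear B); last first.
  by have [u [c [_ _ <-]]] := kerpi_repP x; rewrite tensor_eval_out.
have [C BC] := bdd_bilinear_le HB; have C0 : 0 <= C by case: BC.
apply/eqP; rewrite -normr_le0; apply/ler_addgt0Pr => e e0.
have C1 : 0 < C + 1 by rewrite ltr_wpDl.
have [u [uc _ ux]] := kerpi_norm_approx x (divr_gt0 e0 C1).
have := tsum_le BC uc (tensor_evalP uc HB); rewrite ux x0 !add0r => /le_trans; apply.
by rewrite mulrCA -[leRHS]mulr1 ler_wpM2l ?(ltW e0)// ler_pdivrMr// mul1r lerDl.
Qed.

HB.instance Definition _ := Lmodule_isNormed.Build K kerpi
  kerpi_normD kerpi_normZ kerpi_norm0_eq0.

End KernelSpace.

(** * Completeness of the kernel *)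

Lemma geometric_lt (R : realType) (C e : Cplx R) : 0 <= C -> 0 < e ->
  exists n, C / 2 ^+ n < e.
Proof.
move=> C0 e0; have [n] : exists n : nat, fromC (C / e) < n%:R.
  exists (Num.bound (fromC (C / e))).
  by rewrite archi_boundP// -ler_toC fromCK ?divr_ge0// ltW.
rewrite -ltr_toC fromCK ?divr_ge0 ?(ltW e0)// => Cn; exists n.
rewrite ltr_pdivrMr ?exprn_gt0// mulrC -ltr_pdivrMr//; apply: lt_le_trans Cn _.
have -> : toC n%:R = n%:R :> Cplx R by rewrite /toC rmorph_nat.
by rewrite -natrX ler_nat ltnW// ltn_expl.
Qed.

Section KernelComplete.
Variables (R : realType) (A : completeNormedModType (Cplx R)).
Local Notation K := (Cplx R).
Local Notation AK := (A * K)%type.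
Variable mul : A -> A -> A.
Variable HA : is_banach_algebra mul.

(* A fast converging sequence is resummed by spreading representations of its
   increments over one representation; the [n]-th tail of that representation
   represents the limit minus the [n]-th term. *)
Lemma ker_rep_spread (w : nat -> trep A) (d : nat -> kerpi HA) (c : K) : 0 <= c ->
  (forall n, ker_rep mul (w n) (val (d n)) (c / 2 ^+ n)) ->
  exists s : nat -> kerpi HA,
    (forall n, s n = d n + s n.+1) /\ (forall n, `|s n| <= 2 * c / 2 ^+ n).
Proof.
move=> c0 wd; pose W n := tspread (fun j => w (n + j)%N).
have WE n : W n = tinterleave (w n) (W n.+1).
  rewrite /W tspreadE addn0; congr (tinterleave _ (tspread _)).
  by apply/funext => j; rewrite addSnnS.
have Wm n : mass_le (W n) (2 * c / 2 ^+ n).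
  rewrite -mulrA; apply: mass_le_spread => [|j]; first by rewrite divr_ge0// exprn_ge0.
  by rewrite -mulrA -invfM -exprD; case: (wd (n + j)%N).
have cAK : series_complete (A * K)%type.
  apply: series_complete_prod; first exact: series_complete_complete.
  exact: series_complete_Cplx.
have [p Hp] := choice (fun n => tsum_ex cAK (bilinear_le_umul HA) (Wm n)).
(* Each [w n] has product 0, so all tails share one product; it is at most [2 * c / 2 ^+ n] for
   every [n], hence 0, and the tails lie in the kernel. *)
have pS n : p n = p n.+1.
  apply: (tsum_unique (Hp n)); rewrite WE -(add0r (p n.+1)).
  by apply: tsum_interleave; [case: (wd n)|exact: Hp].
have p0n n : p 0%N = p n by elim: n => // n ->.
have p0 : p 0%N = 0.
  apply/eqP; rewrite -normr_le0; apply/ler_addgt0Pr => e e0; rewrite add0r.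
  have [n ne] := geometric_lt (mulr_ge0 (ler0n K 2) c0) e0.
  rewrite (p0n n); apply: le_trans (ltW ne).
  by have := tsum_le (bilinear_le_umul HA) (Wm n) (Hp n); rewrite mul1r.
have Wrep n : ker_rep mul (W n) (tensor_eval (W n)) (2 * c / 2 ^+ n).
  by split=> //; have := Hp n; rewrite -p0n p0.
have Wker n : tensor_eval (W n) \in ker_fun HA.
  by apply/asboolP; exists (W n), (2 * c / 2 ^+ n).
exists (fun n => Kerpi (Wker n)); split=> n; last exact: (@kerpi_norm_le _ _ _ _ _ (W n)).
apply: val_inj; rewrite /= {1}WE.
have [wm _ <-] := wd n.
exact: tensor_eval_interleave wm (Wm n.+1).
Qed.

Lemma kerpi_complete (F : set_system (kerpi HA)) :
  ProperFilter F -> cauchy F -> cvg F.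
Proof.
move=> FF /cauchyP Fc.
have pos n : 0 < (2 ^+ n)^-1 :> K by rewrite invr_gt0 exprn_gt0.
have [x Fx] := choice (fun n => Fc _ (pos n)).
pose d n := x n.+1 - x n.
(* The balls around [x n] and [x n.+1] both belong to [F], so they meet; the triangle inequality
   goes through a common point. *)
have dlt n : `|d n| < 2 / 2 ^+ n.
  have [z [zn zSn]] := filter_ex (filterI (Fx n) (Fx n.+1)).
  move: zn zSn; rewrite -ball_normE /= => zn zSn.
  rewrite /d -(subrK z (x n.+1)) -addrA; apply: le_lt_trans (ler_normD _ _) _.
  rewrite mulr_natl mulr2n; apply: ltrD.
    apply: lt_le_trans zSn _; rewrite lef_pV2 ?posrE ?exprn_gt0//.
    by rewrite exprS ler_peMl ?exprn_ge0// ler1n.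
  by rewrite distrC.
have [w Hw] := choice (fun n => kerpi_norm_lt (dlt n)).
have [s [sS sle]] := ker_rep_spread (ler0n K 2) Hw.
(* [s n] is the sum of the increments from [n] on, so [x n + s n] does not depend on [n] and is the
   candidate limit. *)
have xs n : x 0%N + s 0%N = x n + s n.
  by elim: n => // n ->; rewrite sS addrA (addrC (x n)) subrK.
apply/cvg_ex; exists (x 0%N + s 0%N); apply/fcvgrPdist_lt => e e0.
(* 5 is 1 for the radius of the ball around [x n], plus 4 for the bound [2 * 2 / 2 ^+ n] on
   [s n]. *)
have [n ne] := geometric_lt (ler0n K 5) e0.
have := Fx n; apply: filterS => z; rewrite -ball_normE /= => zn.
apply: lt_trans ne; rewrite (xs n) addrAC; apply: le_lt_trans (ler_normD _ _) _.
have -> : 5 / 2 ^+ n = (2 ^+ n)^-1 + 2 * 2 / 2 ^+ n :> K.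
  by rewrite -{2}[(2 ^+ n)^-1]mul1r -mulrDl -natrM -natr1 addrC.
exact: ltr_leD.
Qed.

HB.instance Definition _ := Uniform_isComplete.Build (kerpi HA) kerpi_complete.

End KernelComplete.

(** * The bimodule structure and the commutator derivation *)

Section KernelModule.
Variables (R : realType) (A : completeNormedModType (Cplx R)).
Local Notation K := (Cplx R).
Local Notation AK := (A * K)%type.
Variable mul : A -> A -> A.
Variable HA : is_banach_algebra mul.
Implicit Types (x y : kerpi HA) (u : trep A) (a b : A) (B : AK -> AK -> K).

(** The actions are defined on this chosen representation; [kerpi_lact_eval] and [kerpi_ract_eval]
    show that any other gives the same result. *)
Definition kerpi_rep x : trep A := projT1 (cid (kerpi_repP x)).

Lemma kerpi_rep_ex x : exists c, ker_rep mul (kerpi_rep x) (val x) c.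
Proof. exact: projT2 (cid (kerpi_repP x)). Qed.

Lemma kerpi_ext x y : (forall B, bdd_bilinear B -> val x B = val y B) -> x = y.
Proof.
move=> xy; apply: val_inj; apply/funext => B.
have [/xy//|HB] := pselect (bdd_bilinear B).
have [u [c [_ _ <-]]] := kerpi_repP x; have [v [d [_ _ <-]]] := kerpi_repP y.
by rewrite !tensor_eval_out.
Qed.

(** The algebra acts by changing the form, so linearity of the actions in the algebra variable is
    linearity of [x] in the form. *)
Lemma kerpi_val_linear x k B B' : bdd_bilinear B -> bdd_bilinear B' ->
  val x (fun p q => k * B p q + B' p q) = k * val x B + val x B'.
Proof.
move=> HB HB'; have [u [c [uc _ <-]]] := kerpi_repP x.
apply: tensor_evalE; last first.
  have := cvgD (cvgZl_tmp (k := k) (tensor_evalP uc HB)) (tensor_evalP uc HB').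
  rewrite /tsum; under [in X in _ -> X]eq_fun do rewrite big_split/= -mulr_sumr.
  exact.
have [C [C0 _ _ BC]] := bdd_bilinear_le HB.
have [C' [C0' _ _ BC']] := bdd_bilinear_le HB'.
have [Bl Br _] := HB; have [Bl' Br' _] := HB'.
split=> [k' p q r|k' p q r|].
- by rewrite Bl Bl' !mulrDr addrACA mulrCA.
- by rewrite Br Br' !mulrDr addrACA mulrCA.
- exists (`|k| * C + C') => p q; apply: le_trans (ler_normD _ _) _.
  rewrite !mulrDl normrM -!mulrA; apply: lerD; last by rewrite mulrA.
  by rewrite ler_wpM2l// mulrA.
Qed.

Lemma kerpi_valP k x y B : val (k *: x + y) B = k * val x B + val y B.
Proof. by []. Qed.

Lemma kerpi_valD x y B : val (x + y) B = val x B + val y B.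
Proof. by []. Qed.

Lemma ker_rep_lact a u phi c : ker_rep mul u phi c ->
  ker_rep mul (tlact mul a u) (tensor_eval (tlact mul a u)) (`|a| * c).
Proof.
move=> [uc upi _]; split => //; first exact: mass_le_lact.
by have := tpi_lact HA (a := a) upi; rewrite (_ : umul _ _ 0 = 0)//
   /umul /= alg_mul0r// scale0r scaler0 mul0r !addr0.
Qed.

Lemma ker_rep_ract a u phi c : ker_rep mul u phi c ->
  ker_rep mul (tract mul u a) (tensor_eval (tract mul u a)) (`|a| * c).
Proof.
move=> [uc upi _]; split => //; first exact: mass_le_ract.
by have := tpi_ract HA (a := a) upi; rewrite (_ : umul _ 0 _ = 0)//
   /umul /= alg_mul0l// !scale0r mul0r !addr0.
Qed.

Lemma ker_fun_lact a x : tensor_eval (tlact mul a (kerpi_rep x)) \in ker_fun HA.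
Proof.
have [c xc] := kerpi_rep_ex x.
by apply/asboolP; exists (tlact mul a (kerpi_rep x)), (`|a| * c); exact: ker_rep_lact xc.
Qed.

Lemma ker_fun_ract a x : tensor_eval (tract mul (kerpi_rep x) a) \in ker_fun HA.
Proof.
have [c xc] := kerpi_rep_ex x.
by apply/asboolP; exists (tract mul (kerpi_rep x) a), (`|a| * c); exact: ker_rep_ract xc.
Qed.

Definition kerpi_lact a x : kerpi HA := Kerpi (ker_fun_lact a x).
Definition kerpi_ract x a : kerpi HA := Kerpi (ker_fun_ract a x).

(** The action is the transpose of precomposition on forms. With [kerpi_ext], this reduces the
    bimodule axioms to identities between forms, which hold by the algebra of the unitization. *)
Lemma kerpi_lactE a x B : bdd_bilinear B ->
  val (kerpi_lact a x) B = val x (fun p q => B (umul mul (uemb a) p) q).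
Proof.
move=> HB; have [c [xc _ <-]] := kerpi_rep_ex x.
exact: (tensor_eval_lact HA a xc HB).
Qed.

Lemma kerpi_ractE a x B : bdd_bilinear B ->
  val (kerpi_ract x a) B = val x (fun p q => B p (umul mul q (uemb a))).
Proof.
move=> HB; have [c [xc _ <-]] := kerpi_rep_ex x.
exact: (tensor_eval_ract HA a xc HB).
Qed.

Lemma kerpi_lact_eval a x u c : mass_le u c -> tensor_eval u = val x ->
  val (kerpi_lact a x) = tensor_eval (tlact mul a u).
Proof.
move=> uc ux; apply/esym/tensor_eval_ext => B HB; last exact: tensor_eval_out.
rewrite kerpi_lactE// -ux; exact: (tensor_evalP uc (bdd_bilinear_lact HA a HB)).
Qed.

Lemma kerpi_ract_eval a x u c : mass_le u c -> tensor_eval u = val x ->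
  val (kerpi_ract x a) = tensor_eval (tract mul u a).
Proof.
move=> uc ux; apply/esym/tensor_eval_ext => B HB; last exact: tensor_eval_out.
rewrite kerpi_ractE// -ux; exact: (tensor_evalP uc (bdd_bilinear_ract HA a HB)).
Qed.

Lemma kerpi_norm_le_scaled x y (k : K) : 0 <= k ->
  (forall u c, ker_rep mul u (val x) c -> exists v, ker_rep mul v (val y) (k * c)) ->
  `|y| <= k * `|x|.
Proof.
move=> k0 xy; apply/ler_addgt0Pr => e e0.
have k1 : 0 < k + 1 by rewrite ltr_wpDl.
have [u /xy[v vy]] := kerpi_norm_approx x (divr_gt0 e0 k1).
apply: le_trans (kerpi_norm_le vy) _.
rewrite mulrDr lerD2l mulrCA -[leRHS]mulr1 ler_wpM2l ?(ltW e0)//.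
by rewrite ler_pdivrMr// mul1r lerDl.
Qed.

Lemma kerpi_lact_norm a x : `|kerpi_lact a x| <= `|a| * `|x|.
Proof.
apply: kerpi_norm_le_scaled => // u c uc; exists (tlact mul a u).
have [um _ ux] := uc; rewrite (kerpi_lact_eval a um ux); exact: ker_rep_lact uc.
Qed.

Lemma kerpi_ract_norm a x : `|kerpi_ract x a| <= `|a| * `|x|.
Proof.
apply: kerpi_norm_le_scaled => // u c uc; exists (tract mul u a).
have [um _ ux] := uc; rewrite (kerpi_ract_eval a um ux); exact: ker_rep_ract uc.
Qed.

Lemma kerpi_bimodule : is_banach_bimodule mul kerpi_lact kerpi_ract.
Proof.
have bl := bdd_bilinear_lact HA; have br := bdd_bilinear_ract HA.
split; [|split; [|split; [|split; [|split; [|split; [|split]]]]]].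
- move=> k a b x; apply: kerpi_ext => B HB; have [Bl _ _] := HB.
  rewrite kerpi_valP !kerpi_lactE// -kerpi_val_linear; [|exact: bl|exact: bl].
  by congr (val x _); apply/funext => p; apply/funext => q; rewrite uembP umulPl// Bl.
- move=> k a x y; apply: kerpi_ext => B HB.
  by rewrite kerpi_valP !kerpi_lactE.
- move=> k x y a; apply: kerpi_ext => B HB.
  by rewrite kerpi_valP !kerpi_ractE.
- move=> k x a b; apply: kerpi_ext => B HB; have [_ Br _] := HB.
  rewrite kerpi_valP !kerpi_ractE// -kerpi_val_linear; [|exact: br|exact: br].
  by congr (val x _); apply/funext => p; apply/funext => q; rewrite uembP umulPr// Br.
- move=> a b x; apply: kerpi_ext => B HB; rewrite !kerpi_lactE//; last exact: bl.
  by congr (val x _); apply/funext => p; apply/funext => q; rewrite -umul_uemb -umulA.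
- move=> x a b; apply: kerpi_ext => B HB; rewrite !kerpi_ractE//; last exact: br.
  by congr (val x _); apply/funext => p; apply/funext => q; rewrite -umul_uemb umulA.
- move=> a x b; apply: kerpi_ext => B HB.
  by rewrite kerpi_ractE// !kerpi_lactE// ?kerpi_ractE//; [exact: bl|exact: br].
- exists 1; split=> // a x; rewrite mul1r.
  by split; [exact: kerpi_lact_norm|exact: kerpi_ract_norm].
Qed.

(** This is [a (x) e - e (x) a], written as the commutator with [e (x) e]. Each of the two terms has
    mass at most the norm of [a], whence the constant 2 below. *)
Definition tcommutator a : trep A := tsub (tlact mul a (tunit A)) (tract mul (tunit A) a).

Lemma ker_rep_commutator a :
  ker_rep mul (tcommutator a) (tensor_eval (tcommutator a)) (2 * `|a|).
Proof.
have m1 := @mass_le_unit R A; split=> //.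
  rewrite mulr_natl mulr2n -(mulr1 `|a|).
  by apply: mass_le_sub; [exact: mass_le_lact|exact: mass_le_ract].
have pu : tpi_is mul (tunit A) (uunit A).
  by have := tsum_unit (bilinear_le_umul HA); rewrite umul1l.
have e1 := umul1r HA (uemb a); have e2 := umul1l HA (uemb a).
have := tsum_sub (bilinear_le_umul HA) (tpi_lact HA (a := a) pu) (tpi_ract HA (a := a) pu).
by rewrite e1 e2 subrr.
Qed.

Lemma ker_fun_commutator a : tensor_eval (tcommutator a) \in ker_fun HA.
Proof.
by apply/asboolP; exists (tcommutator a), (2 * `|a|); exact: ker_rep_commutator.
Qed.

Definition kerpi_der a : kerpi HA := Kerpi (ker_fun_commutator a).

Lemma kerpi_derE a B : bdd_bilinear B ->
  val (kerpi_der a) B = B (uemb a) (uunit A) - B (uunit A) (uemb a).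
Proof.
move=> HB; have [C BC] := bdd_bilinear_le HB; apply: (tensor_evalE HB).
have e1 := umul1r HA (uemb a); have e2 := umul1l HA (uemb a).
have := tsum_sub BC (u := tlact mul a (tunit A)) (v := tract mul (tunit A) a)
  (tsum_unit (bilinear_le_lact HA a BC)) (tsum_unit (bilinear_le_ract HA a BC)).
by rewrite e1 e2.
Qed.

Lemma kerpi_der_norm a : `|kerpi_der a| <= 2 * `|a|.
Proof. exact: (kerpi_norm_le (x := kerpi_der a) (ker_rep_commutator a)). Qed.

(** In [a . D b = ab (x) e - a (x) b] and [D a . b = a (x) b - e (x) ab] the terms [a (x) b]
    cancel. *)
Lemma kerpi_der_derivation : is_derivation mul kerpi_lact kerpi_ract kerpi_der.
Proof.
split=> [k a b|a b]; apply: kerpi_ext => B HB; have [Bl Br _] := HB.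
  rewrite kerpi_valP !kerpi_derE// !uembP Bl Br.
  by rewrite opprD addrACA -mulrBr.
rewrite kerpi_valD kerpi_lactE// kerpi_ractE// !kerpi_derE//; last 2 first.
- exact: bdd_bilinear_ract.
- exact: bdd_bilinear_lact.
have e1 := umul1r HA (uemb a); have e2 := umul1l HA (uemb b).
have e3 := umul_uemb mul a b.
by rewrite e1 e2 e3 addrA subrK.
Qed.

Lemma kerpi_der_continuous : continuous kerpi_der.
Proof.
apply: (bounded_additive_continuous (ler0n K 2)); last exact: kerpi_der_norm.
move=> a b; have [dl _] := kerpi_der_derivation.
by rewrite addrC -scaleN1r dl scaleN1r addrC.
Qed.

End KernelModule.

(** * From derivations to nets *)

Section Necessity.
Variables (R : realType) (A : completeNormedModType (Cplx R)).
Local Notation K := (Cplx R).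
Variable mul : A -> A -> A.
Variable HA : is_banach_algebra mul.
Implicit Types (x y : kerpi HA) (a : A).

Definition diagonal_rep x : trep A := tsub (tunit A) (kerpi_rep x).

Lemma mass_le_diagonal x : exists c, mass_le (diagonal_rep x) c.
Proof.
have [c [xc _ _]] := kerpi_rep_ex x; exists (1 + c).
exact: mass_le_sub (@mass_le_unit R A) xc.
Qed.

Lemma tpi_diagonal x : tpi_is mul (diagonal_rep x) (uunit A).
Proof.
have [c [_ xpi _]] := kerpi_rep_ex x; have PU := bilinear_le_umul HA.
have := tsum_sub PU (tsum_unit PU) xpi.
by have e1 := umul1l HA (uunit A); rewrite e1 subr0.
Qed.

(** As [kerpi_der] is the commutator with [e (x) e], the [ad] of the two diagonals is exactly the
    error of the approximation by [x] and [y]. This identity yields both the convergence and the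
    bound. *)
Lemma tensor_eval_diagonal_ad x y a :
  tensor_eval (tsub (tlact mul a (diagonal_rep x)) (tract mul (diagonal_rep y) a)) =
  val (kerpi_der HA a - (kerpi_lact a x - kerpi_ract y a)).
Proof.
have [c xm] := mass_le_diagonal x; have [d ym] := mass_le_diagonal y.
have [c' [xm' _ xE]] := kerpi_rep_ex x; have [d' [ym' _ yE]] := kerpi_rep_ex y.
have m1 := @mass_le_unit R A.
have fB (f g : (A * K -> A * K -> K) -> K^o) B : (f - g) B = f B - g B by [].
have la u w r s : mass_le u r -> mass_le w s -> tensor_eval (tlact mul a (tsub u w)) =
    tensor_eval (tlact mul a u) - tensor_eval (tlact mul a w).
  move=> ur ws; apply: tensor_eval_ext => B HB; last first.
    by rewrite fB !tensor_eval_out// subrr.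
  have HB' := bdd_bilinear_lact HA a HB; have [C BC] := bdd_bilinear_le HB'.
  rewrite fB (tensor_eval_lact HA a ur HB) (tensor_eval_lact HA a ws HB).
  exact: (tsum_sub BC (tensor_evalP ur HB') (tensor_evalP ws HB')).
have ra u w r s : mass_le u r -> mass_le w s -> tensor_eval (tract mul (tsub u w) a) =
    tensor_eval (tract mul u a) - tensor_eval (tract mul w a).
  move=> ur ws; apply: tensor_eval_ext => B HB; last first.
    by rewrite fB !tensor_eval_out// subrr.
  have HB' := bdd_bilinear_ract HA a HB; have [C BC] := bdd_bilinear_le HB'.
  rewrite fB (tensor_eval_ract HA a ur HB) (tensor_eval_ract HA a ws HB).
  exact: (tsum_sub BC (tensor_evalP ur HB') (tensor_evalP ws HB')).
rewrite (tensor_eval_sub (mass_le_lact HA a xm) (mass_le_ract HA a ym)).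
rewrite /diagonal_rep (la _ _ _ _ m1 xm') (ra _ _ _ _ m1 ym').
have -> : val (kerpi_der HA a - (kerpi_lact a x - kerpi_ract y a)) =
  val (kerpi_der HA a) - (val (kerpi_lact a x) - val (kerpi_ract y a)) by [].
rewrite (kerpi_lact_eval a xm' xE) (kerpi_ract_eval a ym' yE) [val (kerpi_der _ _)]/=.
rewrite (tensor_eval_sub (mass_le_lact HA a m1) (mass_le_ract HA a m1)).
by rewrite !opprD !opprK addrACA.
Qed.

(** The kernel norm is an infimum over fewer representations, those with product 0, so it dominates
    the projective norm. *)
Lemma tnorm_le_kerpi u x c : tensor_eval u = val x -> `|x| <= c -> tnorm_le u c.
Proof.
move=> ux xc e e0; have [v [vm _ vx]] := kerpi_norm_approx x e0.
have [vs vl] := mass_leP vm; exists v; split => //.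
  by apply: tensor_eval_trep_eq; rewrite ux vx.
by apply: le_trans vl _; rewrite lerD2r.
Qed.

End Necessity.

Theorem theorem3p3 (R : realType) (A : completeNormedModType (Cplx R))
    (mul : A -> A -> A) (HA : is_banach_algebra mul) :
  bdd_approx_semi_contractible mul <->
  exists Kc : Cplx R, 0 < Kc /\
  exists (I : Type) (le : I -> I -> Prop) (xi eta : I -> trep A),
    [/\ directed le,
        (forall i, summable_rep (xi i) /\ summable_rep (eta i)),
        (forall a : A, forall e : Cplx R, 0 < e -> exists i0, forall i, le i0 i ->
            tnorm_le (tsub (tlact mul a (xi i)) (tract mul (eta i) a)) e),
        (forall i (a : A),
            tnorm_le (tsub (tlact mul a (xi i)) (tract mul (eta i) a)) (Kc * `|a|)) &
        (forall i, tpi_is mul (xi i) (uunit A) /\ tpi_is mul (eta i) (uunit A))].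
Proof.
split=> [contr|].
  have [Kc [Kc0 [I [le [x [y [dle xycvg xybnd]]]]]]] :=
    contr _ _ _ (kerpi_bimodule HA) _ (kerpi_der_derivation HA)
      (@kerpi_der_continuous _ _ _ HA).
  (* The [ad] of the diagonals is the derivation, bounded by 2, minus an approximant, bounded by
     [Kc]. *)
  exists (2 + Kc); split; first by rewrite addr_gt0.
  exists I, le, (fun i => diagonal_rep (x i)), (fun i => diagonal_rep (y i)).
  split => //.
  - by move=> i; split; apply/summable_repP; exact: mass_le_diagonal.
  - move=> a e e0; have [i0 Hi0] := xycvg a e e0; exists i0 => i /Hi0 xye.
    apply: (tnorm_le_kerpi (tensor_eval_diagonal_ad (x i) (y i) a)).
    by rewrite distrC; exact: ltW.
  - move=> i a; apply: (tnorm_le_kerpi (tensor_eval_diagonal_ad (x i) (y i) a)).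
    rewrite mulrDl; apply: le_trans (ler_normB _ _) _.
    by apply: lerD; [exact: kerpi_der_norm|exact: xybnd].
  - by move=> i; split; exact: tpi_diagonal.
move=> [Kc [Kc0 [I [le [xi [eta [dle sum cvg0 bnd pi1]]]]]]].
move=> Y lact ract HY D HD Dc.
refine (bdd_approx_semi_inner_of_nets HY HD Dc Kc0 dle sum cvg0 bnd _).
by move=> i; case: (pi1 i).
Qed.
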